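(* Let $L=L_{\bar 0}\oplus L_{\bar 1}$ be a nilpotent Lie superalgebra of dimension $(k\mid l)$ with $\dim L^2=(r\mid s)$ and $r+s\ge 1$. Then $$\dim\mathcal{M}^{(2)}(L)\le \tfrac13 (k+l-r-s)\big[(k+l+2r+2s-2)(k+l-r-s-1)+3(r+s-1)\big]+3.$$ Moreover, $$\dim\mathcal{M}^{(2)}(L)\le \tfrac13 (k+l)(k+l-1)(k+l-2)+3,$$ and equality holds in this last inequality if and only if $L\cong H(1,0)\oplus A(k-3\mid l)$.
   Context: Lie superalgebras are over a fixed algebraically closed ground field. For $L=L_{\bar 0}\oplus L_{\bar 1}$, writing $\dim L=(k\mid l)$ means $\dim L_{\bar 0}=k$ and $\dim L_{\bar 1}=l$; in the inequalities $\dim\mathcal{M}^{(2)}(L)$ is the total dimension (even plus odd). $L^2=[L,L]$ is the derived subalgebra. $A(a\mid b)$ denotes the abelian Lie superalgebra of dimension $(a\mid b)$. $H(1,0)$ is the Heisenberg Lie superalgebra of dimension $(3\mid 0)$, i.e. the $3$-dimensional Heisenberg Lie algebra with basis $x_1,x_2,z$ (all even) and only nonzero bracket $[x_1,x_2]=z$. A free presentation of $L$ is a short exact sequence $0\to R\to F\to L\to 0$ of Lie superalgebras with $F$ a free Lie superalgebra (on a $\mathbb{Z}_2$-graded set) and $R$ a graded ideal of $F$. The $2$-nilpotent multiplier is $\mathcal{M}^{(2)}(L)=\dfrac{R\cap F^3}{[[R,F],F]}$, where $F^3=[[F,F],F]$; it is an abelian Lie superalgebra and, up to isomorphism, independent of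 the chosen free presentation.
   Formalization: The ground field is assumed of characteristic different from 2: in characteristic 2, with the bracket-only definition, the claim fails for L with odd y1, y2, even z and only nonzero bracket [y1,y2]=z. *)

(* Defs.v *)
From HB Require Import structures.
From mathcomp Require Import all_boot all_order all_algebra.
From mathcomp Require Import boolp classical_sets.
Set Implicit Arguments.
Unset Strict Implicit.
Unset Printing Implicit Defensive.
Import GRing.Theory.
Local Open Scope classical_set_scope.
Local Open Scope ring_scope.

Section LinearAlgebra.
Variables (K : fieldType) (V : lmodType K).

Definition is_subspace (U : set V) : Prop :=
  U 0 /\ forall (a : K) (x y : V), U x -> U y -> U (a *: x + y).

Definition lin_span (S : set V) : set V :=
  [set x | forall U : set V, is_subspace U -> S `<=` U -> U x].

(* [quot_dim U W d]: the quotient U / W of subspaces W `<=` U is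
   finite-dimensional of dimension d, i.e. d vectors of U form a basis of U
   modulo W.  V itself may be infinite-dimensional. *)
Definition quot_dim (U W : set V) (d : nat) : Prop :=
  exists e : 'I_d -> V,
    [/\ forall i, U (e i),
        forall x, U x -> exists c : 'I_d -> K, W (x - \sum_i c i *: e i)
      & forall c : 'I_d -> K, W (\sum_i c i *: e i) -> forall i, c i = 0].

Definition has_dim (U : set V) (d : nat) : Prop := quot_dim U [set 0] d.

End LinearAlgebra.

(* Parities are booleans: [false] is even, [true] is odd, so that the sign
   attached to parities i and j is (-1) ^+ (i && j).
   The axiom [lsa_cube] follows from the Jacobi identity when 3 is invertible;
   in characteristic 3 it is part of the usual definition.  The definition is
   the usual one only over fields of characteristic different from 2, where
   [x, x] = 0 for even x is a consequence of [lsa_skew]. *)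
Record lieSuperalgebra (K : fieldType) := LieSuperalgebra {
  lsa_sort :> lmodType K;
  homog : bool -> set lsa_sort;
  lsa_br : lsa_sort -> lsa_sort -> lsa_sort;
  lsa_homog_subspace : forall i, is_subspace (homog i);
  lsa_homog_sum : forall x, exists x0 x1,
    [/\ homog false x0, homog true x1 & x = x0 + x1];
  lsa_homog_cap : forall x, homog false x -> homog true x -> x = 0;
  lsa_br_linl : forall (a : K) x y z,
    lsa_br (a *: x + y) z = a *: lsa_br x z + lsa_br y z;
  lsa_br_linr : forall (a : K) x y z,
    lsa_br z (a *: x + y) = a *: lsa_br z x + lsa_br z y;
  lsa_br_homog : forall i j x y,
    homog i x -> homog j y -> homog (i (+) j) (lsa_br x y);
  lsa_skew : forall i j x y, homog i x -> homog j y ->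
    lsa_br x y = - ((-1) ^+ (i && j) *: lsa_br y x);
  lsa_jacobi : forall i j x y z, homog i x -> homog j y ->
    lsa_br x (lsa_br y z) =
      lsa_br (lsa_br x y) z + (-1) ^+ (i && j) *: lsa_br y (lsa_br x z);
  lsa_cube : forall x, homog true x -> lsa_br x (lsa_br x x) = 0
}.

Arguments homog {K} L i : rename.
Arguments lsa_br {K L} x y : rename.

Section LieSuperalgebraTheory.
Variable K : fieldType.
Implicit Types L G H F : lieSuperalgebra K.

Definition lsa_hom G H (f : G -> H) : Prop :=
  [/\ forall (a : K) (x y : G), f (a *: x + y) = a *: f x + f y,
      forall i x, homog G i x -> homog H i (f x)
    & forall x y, f (lsa_br x y) = lsa_br (f x) (f y)].

Definition lsa_iso G H : Prop := exists f : G -> H, lsa_hom f /\ bijective f.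

Definition br_set L (A B : set L) : set L :=
  lin_span [set z | exists x y, [/\ A x, B y & z = lsa_br x y]].

Definition derived L : set L := br_set setT setT.

(* lcs L n is the term L^(n+1) of the lower central series. *)
Fixpoint lcs L (n : nat) : set L :=
  if n is m.+1 then br_set (lcs m) setT else setT.
Arguments lcs L n : clear implicits.

Definition lsa_nilpotent L : Prop := exists n, lcs L n = [set 0].

Definition has_sdim L (U : set L) (k l : nat) : Prop :=
  has_dim (U `&` homog L false) k /\ has_dim (U `&` homog L true) l.

(* F is free on the Z/2-graded set (X, p) via the map i. *)
Definition is_free_on F (X : Type) (p : X -> bool) (i : X -> F) : Prop :=
  (forall x, homog F (p x) (i x)) /\
  forall G (f : X -> G), (forall x, homog G (p x) (f x)) ->
    (exists phi : F -> G, lsa_hom phi /\ forall x, phi (i x) = f x) /\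
    (forall phi psi : F -> G, lsa_hom phi -> lsa_hom psi ->
       (forall x, phi (i x) = f x) -> (forall x, psi (i x) = f x) ->
       phi =1 psi).

(* The relation ideal R is the kernel of the projection [fp_proj]. *)
Record free_presentation L := FreePresentation {
  fp_gen : Type;
  fp_par : fp_gen -> bool;
  fp_free : lieSuperalgebra K;
  fp_incl : fp_gen -> fp_free;
  fp_proj : fp_free -> L;
  fp_freeP : is_free_on fp_par fp_incl;
  fp_projP : lsa_hom fp_proj;
  fp_surj : forall y, exists x, fp_proj x = y
}.

Arguments fp_proj {L} P x : rename.

Definition fp_rel L (P : free_presentation L) : set (fp_free P) :=
  [set x | fp_proj P x = 0].
Arguments fp_rel {L} P.

Definition mult2_num L (P : free_presentation L) : set (fp_free P) :=
  fp_rel P `&` br_set (br_set setT setT) setT.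
Arguments mult2_num {L} P.

Definition mult2_den L (P : free_presentation L) : set (fp_free P) :=
  br_set (br_set (fp_rel P) setT) setT.
Arguments mult2_den {L} P.

(* The 2-nilpotent multiplier computed from P has total dimension d. *)
Definition mult2_dim L (P : free_presentation L) (d : nat) : Prop :=
  quot_dim (mult2_num P) (mult2_den P) d.

End LieSuperalgebraTheory.

Arguments derived {K} L.
Arguments lcs {K} L n.
Arguments fp_proj {K L} P x : rename.
Arguments fp_rel {K L} P.
Arguments mult2_num {K L} P.
Arguments mult2_den {K L} P.

Section Abelian.
Variables (K : fieldType) (a b : nat).
Let V : lmodType K := ('rV[K]_a * 'rV[K]_b)%type.

Definition ab_homog (i : bool) : set V :=
  [set x | if i then x.1 = 0 else x.2 = 0].

Definition ab_br (x y : V) : V := 0.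

Definition lsa_abelian : lieSuperalgebra K.
Proof.
apply: (@LieSuperalgebra K V ab_homog ab_br); rewrite /ab_br.
- by case; split=> //= c x y hx hy; rewrite /ab_homog /= hx hy scaler0 addr0.
- move=> x; exists (x.1, 0), (0, x.2); split=> //.
  by case: x => x1 x2; congr pair; rewrite /= ?addr0 ?add0r.
- by move=> [x1 x2] /= -> ->.
- by move=> *; rewrite scaler0 addr0.
- by move=> *; rewrite scaler0 addr0.
- by move=> i j x y _ _; case: (i (+) j).
- by move=> *; rewrite scaler0 oppr0.
- by move=> *; rewrite scaler0 addr0.
- by [].
Defined.

End Abelian.

(* The Heisenberg Lie superalgebra H(1,0): row vectors of length 3, all even,
   with standard basis x1, x2, z and [x1, x2] = z. *)
Section Heisenberg.
Variable K : fieldType.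
Let V : lmodType K := 'rV[K]_3.
Let i0 : 'I_3 := @Ordinal 3 0 isT.
Let i1 : 'I_3 := @Ordinal 3 1 isT.
Let i2 : 'I_3 := @Ordinal 3 2 isT.

Definition heis_homog (i : bool) : set V := if i then [set 0] else setT.

Definition heis_br (u v : V) : V :=
  (u 0 i0 * v 0 i1 - u 0 i1 * v 0 i0) *: delta_mx 0 i2.

Lemma heis_br0r (u v w : V) : heis_br u (heis_br v w) = 0.
Proof. by rewrite /heis_br !mxE /= !mulr0 subrr scale0r. Qed.

Lemma heis_br0l (u v w : V) : heis_br (heis_br u v) w = 0.
Proof. by rewrite /heis_br !mxE /= !mulr0 !mul0r subrr scale0r. Qed.

Lemma heis_brC (u v : V) : heis_br u v = - heis_br v u.
Proof.
rewrite /heis_br -scaleNr opprB; congr (_ *: _).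
by rewrite [v 0 i1 * _]mulrC [v 0 i0 * _]mulrC.
Qed.

Lemma heis_br_linl (a : K) (x y z : V) :
  heis_br (a *: x + y) z = a *: heis_br x z + heis_br y z.
Proof.
rewrite /heis_br scalerA -scalerDl !mxE; congr (_ *: _).
by rewrite !mulrDl mulrBr !mulrA opprD addrACA.
Qed.

Lemma heis_br_linr (a : K) (x y z : V) :
  heis_br z (a *: x + y) = a *: heis_br z x + heis_br z y.
Proof.
by rewrite heis_brC heis_br_linl opprD -scalerN -!(heis_brC z).
Qed.

Definition lsa_heis : lieSuperalgebra K.
Proof.
apply: (@LieSuperalgebra K V heis_homog heis_br).
- by case; split=> //= c x y -> ->; rewrite scaler0 addr0.
- by move=> x; exists x, 0; split; rewrite ?addr0.
- by [].
- exact: heis_br_linl.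
- exact: heis_br_linr.
- move=> [] [] x y //= hx hy.
  + by rewrite /heis_homog hx /= /heis_br !mxE !mul0r subrr scale0r.
  + by rewrite /heis_homog hy /= /heis_br !mxE !mulr0 subrr scale0r.
- move=> i j x y hx hy; case: i hx => /= hx; last first.
    by rewrite expr0 scale1r heis_brC.
  by rewrite hx heis_brC /heis_br !mxE !mulr0 subrr scale0r scaler0.
- by move=> *; rewrite !heis_br0r heis_br0l scaler0 addr0.
- by move=> *; rewrite heis_br0r.
Defined.

End Heisenberg.

Section DirectSum.
Variables (K : fieldType) (G H : lieSuperalgebra K).
Let V : lmodType K := (lsa_sort G * lsa_sort H)%type.

Definition dsum_homog (i : bool) : set V :=
  [set x | homog G i x.1 /\ homog H i x.2].

Definition dsum_br (x y : V) : V := (lsa_br x.1 y.1, lsa_br x.2 y.2).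

Definition lsa_dsum : lieSuperalgebra K.
Proof.
apply: (@LieSuperalgebra K V dsum_homog dsum_br); rewrite /dsum_br.
- move=> i; have [g0 gl] := lsa_homog_subspace G i.
  have [h0 hl] := lsa_homog_subspace H i.
  by split=> // c x y [? ?] [? ?]; split; [apply: gl | apply: hl].
- move=> [x y]; have [x0 [x1 [? ? ->]]] := lsa_homog_sum x.
  by have [y0 [y1 [? ? ->]]] := lsa_homog_sum y; exists (x0, y0), (x1, y1).
- move=> [x y] [/= x0 y0] [/= x1 y1].
  by rewrite (lsa_homog_cap x0 x1) (lsa_homog_cap y0 y1).
- by move=> c x y z; congr pair; rewrite lsa_br_linl.
- by move=> c x y z; congr pair; rewrite lsa_br_linr.
- by move=> i j x y [? ?] [? ?]; split; apply: lsa_br_homog.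
- move=> i j x y [x1 x2] [y1 y2].
  by congr pair; apply: lsa_skew.
- move=> i j x y z [x1 x2] [y1 y2].
  by congr pair; apply: lsa_jacobi.
- by move=> x [x1 x2] /=; rewrite !lsa_cube.
Defined.

End DirectSum.

(* Main.v *)
From HB Require Import structures.
Require Import Defs.
From mathcomp Require Import all_boot all_order all_algebra.
From mathcomp Require Import boolp classical_sets.
From mathcomp Require Import zify ring.
Set Implicit Arguments.
Unset Strict Implicit.
Unset Printing Implicit Defensive.
Import GRing.Theory Num.Theory.
Local Open Scope classical_set_scope.
Local Open Scope ring_scope.

(** Let F be the Lie superalgebra of the presentation, R the kernel of F -> L, and
    write double_br A for [[A, F], F].  The multiplier is the quotient of
    R ∩ double_br F by double_br R, so everything happens inside F, with graded
    ideals in place of quotient algebras.  Put t = dim L/L² and m + 1 = dim L².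

    Upper bound.  Let D be the preimage of L².  As L is nilpotent, D can be
    reached from R by adding, one at a time, homogeneous elements s of [F, F]
    such that [s, F] lies in the ideal already built.  Passing from R to
    R + <s> changes double_br by at most the span of the [[s, v_i], v_j], where
    v_1, ..., v_t is a basis of F modulo D ([double_br_adjoin_span]); each of
    these steps costs t².  At the end, double_br F modulo double_br D is spanned
    by the Hall commutators [[v_p, v_q], v_r] with p < q and p <= r
    ([lcs2_hall_span]), and there are (t³ - t)/3 of them ([card_hall]).  The
    constant 3 comes from the last line: when D = R + <z> with z = [a, b],
    Jacobi rewrites every [z, y] through [z, a] and [z, b], hence every
    [[z, x], y] through four elements.  If a and b are even, [z, z] = 0
    identifies two of them and leaves 3.  If some odd element is involved, the
    identity [[x, x], x] = 0 or the relation [b, b] ∈ R leaves at most 2, and so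
    does a second pair c, d orthogonal to a and b with [c, d] outside R
    ([derived_line_cases]).

    The first inequality is this count, and the second follows since
    (t³ - t)/3 + m t² + 3 <= ((t + m)³ - (t + m))/3 + 3, strictly if m > 0
    (nilpotency forces t > 0).  So equality in the second forces m = 0 and the
    case of 3 elements, in which the orthogonal of <a, b> is central and L is
    H(1,0) ⊕ A ([heis_structure]).

    Lower bound.  For L = H(1,0) ⊕ A one needs the (t³ - t)/3 Hall commutators
    of weight 3 and the elements [[z, a], a], [[z, a], b], [[z, b], b] to be
    independent modulo double_br R.  The coefficient of a word w = w_1 ... w_n in
    the free associative algebra is the corner entry in the representation by
    matrices of size n + 1 that sends a letter x to the sum of the elementary
    matrices E_(i, i+1) with w_i = x.  With a suitable grading these are
    homomorphisms from F to a Lie superalgebra of matrices which kill double_br R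
    for reasons of degree ([word_functional]), and suitable words give functionals
    dual to the chosen elements ([hall_word_dual], [quad_word_dual]). *)

Local Notation "x ∙ y" := (lsa_br x y) (at level 40, left associativity).

(** * Relative dimension *)

Section RelativeDimension.
Variables (K : fieldType) (V : lmodType K).
Implicit Types (U W X : set V) (T : finType).

Lemma subspace0 U : is_subspace U -> U 0.
Proof. by case. Qed.

Lemma subspaceZ U a x : is_subspace U -> U x -> U (a *: x).
Proof. by case=> U0 Ul Ux; rewrite -[_ *: _]addr0; apply: Ul. Qed.

Lemma subspaceD U x y : is_subspace U -> U x -> U y -> U (x + y).
Proof. by case=> _ Ul Ux Uy; rewrite -[x]scale1r; apply: Ul. Qed.

Lemma subspaceN U x : is_subspace U -> U x -> U (- x).
Proof. by move=> sU Ux; rewrite -scaleN1r; apply: subspaceZ. Qed.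

Lemma subspaceB U x y : is_subspace U -> U x -> U y -> U (x - y).
Proof. by move=> sU Ux Uy; apply: subspaceD => //; apply: subspaceN. Qed.

Lemma subspaceZI U a x : is_subspace U -> a != 0 -> U (a *: x) -> U x.
Proof.
by move=> sU a0 /(subspaceZ a^-1 sU); rewrite scalerA mulVf // scale1r.
Qed.

Lemma subspaceDl U x y : is_subspace U -> U y -> U (x + y) -> U x.
Proof. by move=> sU Uy Uxy; rewrite -(addrK y x); apply: subspaceB. Qed.

Lemma subspace_sum U (I : Type) (r : seq I) (f : I -> V) :
  is_subspace U -> (forall i, U (f i)) -> U (\sum_(i <- r) f i).
Proof.
move=> sU Uf; elim/big_ind: _ => //; first exact: subspace0.
by move=> *; apply: subspaceD.
Qed.

Lemma subspace_zero : is_subspace ([set 0] : set V).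
Proof. by split=> //= a x y -> ->; rewrite scaler0 addr0. Qed.

Lemma subspaceI U W : is_subspace U -> is_subspace W -> is_subspace (U `&` W).
Proof.
by move=> [? lU] [? lW]; split=> // a x y [? ?] [? ?]; split; [apply: lU | apply: lW].
Qed.

Lemma lin_span_subspace (S : set V) : is_subspace (lin_span S).
Proof.
split=> [U [] //|a x y Sx Sy U sU SU].
by have [_] := sU; apply; [apply: Sx | apply: Sy].
Qed.

(** The subspace W + <e_i>.  Working modulo W replaces the passage to a quotient
    space of the infinite-dimensional V. *)
Definition spanm W T (e : T -> V) : set V :=
  [set x | exists c : T -> K, W (x - \sum_i c i *: e i)].

Definition indepm W T (e : T -> V) : Prop :=
  forall c : T -> K, W (\sum_i c i *: e i) -> forall i, c i = 0.

Lemma spanm_subspace W T (e : T -> V) : is_subspace W -> is_subspace (spanm W e).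
Proof.
move=> sW; split=> [|a x y [c Wx] [d Wy]].
  exists (fun=> 0); rewrite big1 => [|i _]; last by rewrite scale0r.
  by rewrite subr0; apply: subspace0.
exists (fun i => a * c i + d i).
rewrite (eq_bigr (fun i => a *: (c i *: e i) + d i *: e i)); last first.
  by move=> i _; rewrite scalerDl scalerA.
rewrite big_split /= -scaler_sumr opprD addrACA -scalerBr.
by have [_] := sW; apply.
Qed.

Lemma sub_spanm W T (e : T -> V) : is_subspace W -> W `<=` spanm W e.
Proof.
move=> sW x Wx; exists (fun=> 0); rewrite big1 ?subr0// => i _.
by rewrite scale0r.
Qed.

Lemma mem_spanm W T (e : T -> V) i : is_subspace W -> spanm W e (e i).
Proof.
move=> sW; exists (fun j => (j == i)%:R).
rewrite (bigD1 i) //= eqxx scale1r big1 => [|j /negPf ->]; last by rewrite scale0r.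
by rewrite addr0 subrr; apply: subspace0.
Qed.

Lemma spanm_min W T (e : T -> V) X :
  is_subspace X -> W `<=` X -> (forall i, X (e i)) -> spanm W e `<=` X.
Proof.
move=> sX WX Xe x [c /WX]; apply: subspaceDl => //; apply: subspaceN => //.
by apply: subspace_sum => // i; apply: subspaceZ.
Qed.

Lemma spanm_trans U W W' T T' (e : T -> V) (e' : T' -> V) :
  is_subspace W -> U `<=` spanm W' e -> W' `<=` spanm W e' ->
  exists f : T + T' -> V, U `<=` spanm W f.
Proof.
move=> sW UW' W'W; pose f (i : T + T') := match i with inl i => e i | inr i => e' i end.
have sf : is_subspace (spanm W f) by apply: spanm_subspace.
exists f; apply: subset_trans UW' _; apply: spanm_min => // [|i].
  apply: subset_trans W'W _; apply: spanm_min => // [|i]; first exact: sub_spanm.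
  exact: (mem_spanm f (inr i)).
exact: (mem_spanm f (inl i)).
Qed.

(** Steinitz: if T were larger than T', the matrix of coefficients of e in f
    would have a nonzero left kernel, that is, a relation between the e_i. *)
Lemma indepm_le_spanm U W T T' (e : T -> V) (f : T' -> V) :
  is_subspace W -> (forall i, U (e i)) -> indepm W e -> U `<=` spanm W f ->
  (#|T| <= #|T'|)%N.
Proof.
move=> sW Ue ie Uf; rewrite leqNgt; apply/negP => lt_T'T.
have /choice[c Wc] : forall i, exists c : T' -> K, W (e i - \sum_j c j *: f j).
  by move=> i; apply: Uf.
pose A : 'M[K]_(#|T|, #|T'|) := \matrix_(i, j) c (enum_val i) (enum_val j).
have : kermx A != 0.
  rewrite kermx_eq0 /row_free neq_ltn; apply/orP; left.
  exact: leq_ltn_trans (rank_leq_col A) lt_T'T.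
case/rowV0Pn => u /sub_kermxP uA0 /eqP[]; apply/rowP => i; rewrite [RHS]mxE.
pose u' x := u 0 (enum_rank x).
suff Wu : W (\sum_x u' x *: e x) by rewrite -(ie u' Wu (enum_val i)) /u' enum_valK.
have -> : \sum_x u' x *: e x = \sum_x u' x *: (e x - \sum_j c x j *: f j).
  rewrite [RHS](eq_bigr (fun x => u' x *: e x - \sum_j (u' x * c x j) *: f j)); last first.
    move=> x _; rewrite scalerBr; congr (_ - _); rewrite scaler_sumr.
    by apply: eq_bigr => j _; rewrite scalerA.
  rewrite [RHS]big_split/= sumrN exchange_big /= [X in _ - X]big1 ?subr0// => j _.
  rewrite -scaler_suml; suff -> : \sum_x u' x * c x j = 0 by rewrite scale0r.
  transitivity ((u *m A) 0 (enum_rank j)); last by rewrite uA0 mxE.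
  rewrite mxE (reindex (@enum_val T T)) /=; last first.
    by exists enum_rank => ? _; [apply: enum_valK | apply: enum_rankK].
  by apply: eq_bigr => l _; rewrite /A mxE /u' enum_valK enum_rankK.
by apply: subspace_sum => // x; apply: subspaceZ.
Qed.

(** A family of maximal size in U that is independent modulo W spans U. *)
Lemma quot_dim_spanm U W T (e : T -> V) :
  is_subspace W -> U `<=` spanm W e -> exists2 d, (d <= #|T|)%N & quot_dim U W d.
Proof.
move=> sW Ue.
pose P d := `[< exists2 f : 'I_d -> V, forall i, U (f i) & indepm W f >].
have exP : exists d, P d.
  by exists 0; apply/asboolP; exists (fun=> 0) => [[]|c _ []].
have leP d : P d -> (d <= #|T|)%N.
  by move=> /asboolP[f Uf fi]; rewrite -[d]card_ord; apply: indepm_le_spanm Uf fi Ue.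
case: (ex_maxnP exP leP) => d Pd maxd; exists d; first exact: leP.
case/asboolP: Pd => f Uf fi; exists f; split=> // x Ux; apply: contrapT => nx.
suff : P d.+1 by move/maxd; rewrite ltnn.
apply/asboolP; exists (fun i => if unlift ord0 i is Some j then f j else x).
  by move=> i; case: unlift => [j|]//; apply: Uf.
move=> c; rewrite big_ord_recl unlift_none.
under eq_bigr => i _ do rewrite liftK.
move=> Wc; have c0 : c ord0 = 0.
  apply: contra_notP nx => /eqP c0.
  exists (fun i => - ((c ord0)^-1 * c (lift ord0 i))).
  rewrite (eq_bigr (fun i => - ((c ord0)^-1 *: (c (lift ord0 i) *: f i)))).
    rewrite sumrN opprK -scaler_sumr -[x in x + _](scalerK c0) -scalerDr.
    exact: subspaceZ.
  by move=> i _; rewrite scaleNr scalerA.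
move: Wc; rewrite c0 scale0r add0r => /fi ci i.
by case: (unliftP ord0 i) => [j ->|->].
Qed.

Lemma quot_dim_fin U W T (e : T -> V) :
  (forall i, U (e i)) -> U `<=` spanm W e -> indepm W e -> quot_dim U W #|T|.
Proof.
move=> Ue sUe ie.
have bij_ev : {on [pred i : T | true], bijective (@enum_val T T)}.
  by exists enum_rank => ? _; [apply: enum_valK | apply: enum_rankK].
exists (e \o enum_val); split=> [i|x /sUe[c Wc]|c]; first exact: Ue.
  by exists (c \o enum_val); rewrite (reindex _ bij_ev) in Wc.
have -> : \sum_i c i *: (e \o enum_val) i = \sum_x c (enum_rank x) *: e x.
  by rewrite [RHS](reindex _ bij_ev) /=; apply: eq_bigr => i _; rewrite enum_valK.
by move=> /(ie (c \o enum_rank)) ci i; rewrite -[i]enum_valK; apply: ci.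
Qed.

Lemma quot_dim_le_spanm U W d T (f : T -> V) :
  is_subspace W -> quot_dim U W d -> U `<=` spanm W f -> (d <= #|T|)%N.
Proof.
by move=> sW [e [Ue _ ie]] Uf; rewrite -[d]card_ord; apply: indepm_le_spanm Ue ie Uf.
Qed.

Lemma indepm_le_quot_dim U W d T (f : T -> V) : is_subspace W ->
  (forall i, U (f i)) -> indepm W f -> quot_dim U W d -> (#|T| <= d)%N.
Proof.
by move=> sW Uf fi [e [_ se _]]; rewrite -[d]card_ord; apply: indepm_le_spanm Uf fi se.
Qed.

Lemma quot_dim_unique U W d d' :
  is_subspace W -> quot_dim U W d -> quot_dim U W d' -> d = d'.
Proof.
move=> sW Ud Ud'; apply/eqP; rewrite eqn_leq -{1}[d']card_ord -{2}[d]card_ord.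
have [e [_ se _]] := Ud; have [e' [_ se' _]] := Ud'.
by rewrite (quot_dim_le_spanm sW Ud se') (quot_dim_le_spanm sW Ud' se).
Qed.

Lemma quot_dim_add U W' W q r : is_subspace W -> is_subspace W' ->
  W `<=` W' -> W' `<=` U -> quot_dim U W' q -> quot_dim W' W r ->
  quot_dim U W (q + r).
Proof.
move=> sW sW' WW' W'U [e [Ue se ie]] [f [W'f sf jf]].
pose g (i : 'I_q + 'I_r) := match i with inl i => e i | inr i => f i end.
rewrite -[q]card_ord -[r]card_ord -card_sum.
apply: (@quot_dim_fin _ _ _ g).
- by case=> i /=; [apply: Ue | apply/W'U/W'f].
- move=> x /se[c] /sf[d Wd].
  exists (fun i : 'I_q + 'I_r => match i with inl i => c i | inr i => d i end).
  by rewrite big_sumType /= opprD addrA.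
- move=> c; rewrite big_sumType /= => Wc.
  have c0 : forall i, c (inl i) = 0.
    apply: (ie (c \o inl)); apply: subspaceDl (WW' _ Wc) => //.
    by apply: subspace_sum => // i; apply: subspaceZ.
  move: Wc; rewrite big1 => [|i _]; last by rewrite c0 scale0r.
  rewrite add0r => /(jf (c \o inr)) d0 [] i; [exact: c0 | exact: d0].
Qed.

Lemma quot_dim_sub U W' W k r : is_subspace W -> is_subspace W' ->
  W `<=` W' -> W' `<=` U -> quot_dim U W k -> quot_dim W' W r ->
  exists2 q, quot_dim U W' q & k = (q + r)%N.
Proof.
move=> sW sW' WW' W'U Uk W'r; have [e [_ se _]] := Uk.
have sUe : U `<=` spanm W' e by move=> x /se[c /WW'] ?; exists c.
have [q _ Uq] := quot_dim_spanm sW' sUe; exists q => //.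
exact: quot_dim_unique Uk (quot_dim_add sW sW' WW' W'U Uq W'r).
Qed.

Lemma quot_dim_line W s :
  is_subspace W -> ~ W s -> quot_dim (spanm W (fun _ : 'I_1 => s)) W 1.
Proof.
move=> sW Ws; exists (fun=> s); split=> [i||c].
- exact: (mem_spanm (fun=> s) i sW).
- by [].
- rewrite big_ord1 => Wc i; rewrite ord1; apply: contrapT => /eqP c0.
  by apply: Ws; apply: subspaceZI Wc.
Qed.

(** This drives the induction on dim L²: adjoining to W one new vector of U
    lowers the dimension of U / W by exactly one. *)
Lemma quot_dim_exchange U W d s : is_subspace W -> is_subspace U -> W `<=` U ->
  U s -> ~ W s -> quot_dim U W d ->
  exists2 d', quot_dim U (spanm W (fun _ : 'I_1 => s)) d' & d = d'.+1.
Proof.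
move=> sW sU WU Us Ws Ud.
have sX := spanm_subspace (fun _ : 'I_1 => s) sW.
have [||d' ? ->] := quot_dim_sub sW sX _ _ Ud (quot_dim_line sW Ws).
- exact: sub_spanm.
- exact: spanm_min.
- by exists d'; rewrite ?addn1.
Qed.

End RelativeDimension.

Section Preimage.
Variables (K : fieldType) (V V' : lmodType K) (f : V -> V').
Hypothesis f_lin : forall (a : K) (x y : V), f (a *: x + y) = a *: f x + f y.

Lemma lin0 : f 0 = 0.
Proof. by have := f_lin (-1) 0 0; rewrite scaler0 addr0 scaleN1r addNr. Qed.

Lemma linD x y : f (x + y) = f x + f y.
Proof. by have := f_lin 1 x y; rewrite !scale1r. Qed.

Lemma linZ a x : f (a *: x) = a *: f x.
Proof. by have := f_lin a x 0; rewrite !addr0 lin0 addr0. Qed.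

Lemma linB x y : f (x - y) = f x - f y.
Proof. by rewrite linD -scaleN1r linZ scaleN1r. Qed.

Lemma lin_sum (T : finType) (g : T -> V) : f (\sum_i g i) = \sum_i f (g i).
Proof. by elim/big_rec2: _ => [|i y x _ <-]; [apply: lin0 | rewrite linD]. Qed.

Lemma preim_subspace U : is_subspace U -> is_subspace [set x | U (f x)].
Proof.
move=> sU; split=> [|a x y /= Ux Uy]; first by rewrite /= lin0; apply: subspace0.
by rewrite f_lin; have [_] := sU; apply.
Qed.

Lemma preim_quot_dim U W d : (forall y, exists x, f x = y) ->
  quot_dim U W d -> quot_dim [set x | U (f x)] [set x | W (f x)] d.
Proof.
move=> f_surj [e [Ue se ie]].
have /choice[g fg] : forall i, exists x, f x = e i by move=> i; apply: f_surj.
have sumg c : f (\sum_i c i *: g i) = \sum_i c i *: e i.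
  by rewrite lin_sum; apply: eq_bigr => i _; rewrite linZ fg.
exists g; split=> [i|x /= /se[c Wc]|c /=]; first by rewrite /= fg.
  by exists c; rewrite /= linB sumg.
by rewrite sumg; apply: ie.
Qed.

End Preimage.

Local Notation adjoin R s := (spanm R (fun _ : 'I_1 => s)).

(** * Graded subspaces and ideals *)

Section GradedSubspaces.
Variables (K : fieldType) (F : lieSuperalgebra K).
Implicit Types (A B R X : set F) (x y z : F).

Definition homogeneous x := exists i, homog F i x.

Definition graded A := forall x0 x1,
  homog F false x0 -> homog F true x1 -> A (x0 + x1) -> A x0 /\ A x1.

Lemma gradedP A x : graded A -> A x -> exists x0 x1,
  [/\ homog F false x0, homog F true x1, A x0, A x1 & x = x0 + x1].
Proof.
move=> gA; have [x0 [x1 [h0 h1 ->]]] := lsa_homog_sum x => Ax.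
by have [? ?] := gA _ _ h0 h1 Ax; exists x0, x1.
Qed.

Lemma graded_sub A X : graded A -> is_subspace X ->
  (forall x, homogeneous x -> A x -> X x) -> A `<=` X.
Proof.
move=> gA sX AX x /(gradedP gA)[x0 [x1 [h0 h1 A0 A1 ->]]].
by apply: subspaceD => //; apply: AX => //; [exists false | exists true].
Qed.

Lemma gradedT : graded setT. Proof. by []. Qed.

Lemma homogB i x y : homog F i x -> homog F i y -> homog F i (x - y).
Proof. by apply: subspaceB; apply: lsa_homog_subspace. Qed.

Lemma homog_sum_inj x0 x1 y0 y1 : homog F false x0 -> homog F true x1 ->
  homog F false y0 -> homog F true y1 -> x0 + x1 = y0 + y1 -> x0 = y0 /\ x1 = y1.
Proof.
move=> hx0 hx1 hy0 hy1 e; have e' : x0 - y0 = y1 - x1.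
  by apply/eqP; rewrite subr_eq addrAC eq_sym subr_eq e addrC.
have x0y0 : x0 - y0 = 0.
  by apply: lsa_homog_cap; [apply: homogB | rewrite e'; apply: homogB].
by move: (e'); rewrite x0y0 => /esym/subr0_eq ->; rewrite (subr0_eq x0y0).
Qed.

(** The elements whose two components lie in the span form a subspace; if it
    contains S, it is the whole span. *)
Lemma graded_lin_span (S : set F) :
  (forall x, S x -> exists x0 x1, [/\ homog F false x0, homog F true x1,
     lin_span S x0, lin_span S x1 & x = x0 + x1]) -> graded (lin_span S).
Proof.
move=> hS x0 x1 h0 h1 Sx.
pose X := [set x | exists y0 y1, [/\ homog F false y0, homog F true y1,
  lin_span S y0, lin_span S y1 & x = y0 + y1]].
have sS := lin_span_subspace S; have sh i := lsa_homog_subspace F i.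
have sX : is_subspace X.
  split=> [|a x y [u0 [u1 [? ? ? ? ->]]] [v0 [v1 [? ? ? ? ->]]]].
    by exists 0, 0; rewrite addr0; split=> //; apply: subspace0.
  exists (a *: u0 + v0), (a *: u1 + v1); rewrite scalerDr addrACA; split=> //;
    by [apply: (sh _).2 | apply: sS.2].
have [y0 [y1 [hy0 hy1 Sy0 Sy1 e]]] : X (x0 + x1) by apply: Sx.
by have [-> ->] := homog_sum_inj h0 h1 hy0 hy1 e.
Qed.

Lemma br0l y : 0 ∙ y = 0 :> F.
Proof. exact: (lin0 (fun a u v => lsa_br_linl a u v y)). Qed.
Lemma br0r y : y ∙ 0 = 0 :> F.
Proof. exact: (lin0 (fun a u v => lsa_br_linr a u v y)). Qed.
Lemma brDl x y z : (x + y) ∙ z = x ∙ z + y ∙ z.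
Proof. exact: (linD (fun a u v => lsa_br_linl a u v z)). Qed.
Lemma brDr x y z : z ∙ (x + y) = z ∙ x + z ∙ y.
Proof. exact: (linD (fun a u v => lsa_br_linr a u v z)). Qed.
Lemma brZl a x z : (a *: x) ∙ z = a *: (x ∙ z).
Proof. exact: (linZ (fun a u v => lsa_br_linl a u v z)). Qed.
Lemma brZr a x z : z ∙ (a *: x) = a *: (z ∙ x).
Proof. exact: (linZ (fun a u v => lsa_br_linr a u v z)). Qed.

Lemma brNl x z : (- x) ∙ z = - (x ∙ z).
Proof. by rewrite -scaleN1r brZl scaleN1r. Qed.
Lemma brNr x z : z ∙ (- x) = - (z ∙ x).
Proof. by rewrite -scaleN1r brZr scaleN1r. Qed.

Lemma br_preiml X z : is_subspace X -> is_subspace [set x | X (x ∙ z)].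
Proof. exact: (preim_subspace (fun a u v => lsa_br_linl a u v z)). Qed.
Lemma br_preimr X z : is_subspace X -> is_subspace [set x | X (z ∙ x)].
Proof. exact: (preim_subspace (fun a u v => lsa_br_linr a u v z)). Qed.

Lemma homogeneous_br x y : homogeneous x -> homogeneous y -> homogeneous (x ∙ y).
Proof. by move=> [i hx] [j hy]; exists (i (+) j); apply: lsa_br_homog. Qed.

(** The Jacobi identity read as: ad z acts on the right as a superderivation. *)
Lemma brA i j k x y z : homog F i x -> homog F j y -> homog F k z ->
  x ∙ y ∙ z = x ∙ (y ∙ z) + (-1) ^+ (j && k) *: (x ∙ z ∙ y).
Proof.
move=> hx hy hz; rewrite (lsa_jacobi z hx hy) (lsa_skew hy (lsa_br_homog hx hz)).
by case: i j k {hx hy hz} => [] [] [];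
  rewrite /= ?expr0 ?expr1 ?scaleN1r ?scale1r ?opprK ?addrK ?subrK.
Qed.

Section Membership.
Variable X : set F.
Hypothesis sX : is_subspace X.

Lemma brC_mem x y : homogeneous x -> homogeneous y -> X (x ∙ y) -> X (y ∙ x).
Proof.
move=> [i hx] [j hy] Xxy; rewrite (lsa_skew hy hx).
by apply: subspaceN => //; apply: subspaceZ.
Qed.

(** Membership in a subspace does not see signs.  This and the next lemma are
    the forms of Jacobi in which the parities of x, y, z do not matter. *)
Lemma brA_mem x y z : homogeneous x -> homogeneous y -> homogeneous z ->
  X (x ∙ (y ∙ z)) -> X (x ∙ z ∙ y) -> X (x ∙ y ∙ z).
Proof.
move=> [i hx] [j hy] [k hz] X1 X2; rewrite (brA hx hy hz).
by apply: subspaceD => //; apply: subspaceZ.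
Qed.

Lemma brAr_mem x y z : homogeneous x -> homogeneous y -> homogeneous z ->
  X (x ∙ y ∙ z) -> X (x ∙ z ∙ y) -> X (x ∙ (y ∙ z)).
Proof.
move=> [i hx] [j hy] [k hz] X1 X2; move: X1; rewrite (brA hx hy hz).
by apply: subspaceDl => //; apply: subspaceZ.
Qed.

End Membership.

Lemma br_set_subspace A B : is_subspace (br_set A B).
Proof. exact: lin_span_subspace. Qed.

Lemma mem_br_set A B x y : A x -> B y -> br_set A B (x ∙ y).
Proof. by move=> Ax By U sU; apply; exists x, y. Qed.

Lemma br_set_min A B X : is_subspace X ->
  (forall x y, A x -> B y -> X (x ∙ y)) -> br_set A B `<=` X.
Proof. by move=> sX ABX z; apply=> // _ [x [y [? ? ->]]]; apply: ABX. Qed.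

Lemma br_set_graded A B : graded A -> graded B -> graded (br_set A B).
Proof.
move=> gA gB; apply: graded_lin_span => _ [x [y [Ax By ->]]].
have [x0 [x1 [hx0 hx1 Ax0 Ax1 ->]]] := gradedP gA Ax.
have [y0 [y1 [hy0 hy1 By0 By1 ->]]] := gradedP gB By.
have sAB := br_set_subspace A B; have mAB := @mem_br_set A B.
exists (x0 ∙ y0 + x1 ∙ y1), (x0 ∙ y1 + x1 ∙ y0); split.
- apply: (subspaceD (lsa_homog_subspace F false));
  [exact: (lsa_br_homog hx0 hy0) | exact: (lsa_br_homog hx1 hy1)].
- apply: (subspaceD (lsa_homog_subspace F true));
  [exact: (lsa_br_homog hx0 hy1) | exact: (lsa_br_homog hx1 hy0)].
- by apply: (subspaceD sAB); apply: mAB.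
- by apply: (subspaceD sAB); apply: mAB.
- by rewrite !brDl !brDr [x1 ∙ y0 + _]addrC addrACA.
Qed.

Lemma br_set_min_homog A B X : graded A -> graded B -> is_subspace X ->
  (forall x y, homogeneous x -> homogeneous y -> A x -> B y -> X (x ∙ y)) ->
  br_set A B `<=` X.
Proof.
move=> gA gB sX ABX; apply: br_set_min => // x y Ax By.
suff : B `<=` [set y | X (x ∙ y)] by apply.
apply: (graded_sub gB (br_preimr _ sX)) => {y By} y hy By.
suff : A `<=` [set x | X (x ∙ y)] by apply.
by apply: (graded_sub gA (br_preiml _ sX)) => {Ax x} x hx Ax; apply: ABX.
Qed.

Record is_ideal R : Prop := IsIdeal {
  ideal_subspace : is_subspace R;
  ideal_graded : graded R;
  ideal_br : forall x y, R x -> R (x ∙ y)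
}.

Lemma br_setT_mem_sym R x y : graded R -> R y -> br_set R setT (x ∙ y).
Proof.
move=> gR Ry; have sX := br_set_subspace R setT.
suff : R `<=` [set y | br_set R setT (x ∙ y)] by apply.
apply: (graded_sub gR (br_preimr _ sX)) => {y Ry} y hy Ry.
suff : setT `<=` [set x | br_set R setT (x ∙ y)] by apply.
apply: (graded_sub gradedT (br_preiml _ sX)) => {x} x hx _.
by apply: (brC_mem sX) => //; apply: mem_br_set.
Qed.

Lemma br_set_ideal_sub R : is_ideal R -> br_set R setT `<=` R.
Proof. by case=> sR _ bR; apply: br_set_min => // x y Rx _; apply: bR. Qed.

Lemma br_set_ideal R : is_ideal R -> is_ideal (br_set R setT).
Proof.
move=> iR; split; first exact: br_set_subspace.
  by apply: br_set_graded => //; case: iR.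
by move=> x y Rx; apply: mem_br_set => //; apply: br_set_ideal_sub Rx.
Qed.

Lemma idealT : is_ideal setT. Proof. by []. Qed.

Lemma lcs_ideal n : is_ideal (lcs F n).
Proof. by elim: n => [|n IHn]; [apply: idealT | apply: br_set_ideal]. Qed.

Lemma derived_ideal : is_ideal (derived F).
Proof. exact/br_set_ideal/idealT. Qed.

Lemma lcs_sub_derived n : lcs F n.+1 `<=` derived F.
Proof. by apply: br_set_min => [|x y _ _]; [apply: br_set_subspace | apply: mem_br_set]. Qed.

Lemma br_set_mono A A' B B' : A `<=` A' -> B `<=` B' -> br_set A B `<=` br_set A' B'.
Proof.
move=> AA' BB'; apply: br_set_min => [|x y Ax By]; first exact: br_set_subspace.
by apply: mem_br_set; [apply: AA' | apply: BB'].
Qed.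

Definition double_br R : set F := br_set (br_set R setT) setT.

Lemma double_br_subspace R : is_subspace (double_br R).
Proof. exact: br_set_subspace. Qed.

Lemma mem_double_br R x y z : R x -> double_br R (x ∙ y ∙ z).
Proof. by move=> Rx; do 2 apply: mem_br_set => //. Qed.

(** [r, [y, z]] is a combination of [[r, y], z] and [[r, z], y]; hence
    [R, [F, F]] lies in [[R, F], F]. *)
Lemma double_br_derived R r f : is_ideal R -> R r -> derived F f -> double_br R (r ∙ f).
Proof.
move=> iR Rr; have sX := double_br_subspace R; move: f.
suff : R `<=` [set r | forall f, derived F f -> double_br R (r ∙ f)] by apply.
apply: graded_sub; first by case: iR.
  split=> [f _|a x y Ax Ay f Df]; first by rewrite br0l; apply: subspace0.
  by rewrite lsa_br_linl; apply: sX.2; [apply: Ax | apply: Ay].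
move=> {Rr}r hr Rr; apply: (br_set_min_homog _ _ (br_preimr _ sX)) => //=.
by move=> x y hx hy _ _; apply: (brAr_mem sX) => //; apply: mem_double_br.
Qed.

Lemma derived_double_br R r f : is_ideal R -> derived F f -> R r -> double_br R (f ∙ r).
Proof.
move=> iR Df Rr; have sX := double_br_subspace R; move: f Df.
suff : R `<=` [set r | forall f, derived F f -> double_br R (f ∙ r)] by apply.
apply: graded_sub; first by case: iR.
  split=> [f _|a x y Ax Ay f Df]; first by rewrite br0r; apply: subspace0.
  by rewrite lsa_br_linr; apply: sX.2; [apply: Ax | apply: Ay].
move=> {Rr}r hr Rr; apply: graded_sub (br_preiml _ sX) _.
  by case: derived_ideal.
by move=> f hf Df; apply: (brC_mem sX) => //; apply: double_br_derived.
Qed.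

Lemma double_br_spanm_sub R s X : is_ideal R -> is_subspace X -> double_br R `<=` X ->
  (forall y z, homogeneous y -> homogeneous z -> X (s ∙ y ∙ z)) ->
  double_br (spanm R (fun _ : 'I_1 => s)) `<=` X.
Proof.
move=> iR sX RX Xs; pose Y := [set u : F | forall z, X (u ∙ z)].
have sY : is_subspace Y.
  split=> [z|a x y Ax Ay z]; first by rewrite br0l; apply: subspace0.
  by rewrite lsa_br_linl; apply: sX.2.
suff : br_set (spanm R (fun _ : 'I_1 => s)) setT `<=` Y.
  by move=> SY; apply: br_set_min => // x y /SY.
apply: br_set_min => // x y Sx _; move: y.
suff : spanm R (fun _ : 'I_1 => s) `<=` [set x | forall y, Y (x ∙ y)] by apply.
apply: spanm_min => [|r Rr y z|_ y]; last 2 first.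
- by apply: RX; apply: mem_double_br.
- suff : setT `<=` [set y | Y (s ∙ y)] by apply.
  apply: (graded_sub gradedT (br_preimr _ sY)) => {}y hy _ z.
  suff : setT `<=` [set z | X (s ∙ y ∙ z)] by apply.
  by apply: (graded_sub gradedT (br_preimr _ sX)) => {}z hz _; apply: Xs.
split=> [y z|a u v Au Av y z]; first by rewrite !br0l; apply: subspace0.
by rewrite !lsa_br_linl; apply: sX.2; [apply: Au | apply: Av].
Qed.

Lemma spanm_ideal R s : is_ideal R -> homogeneous s ->
  (forall y, R (s ∙ y)) -> is_ideal (spanm R (fun _ : 'I_1 => s)).
Proof.
move=> [sR gR bR] [i hs] Rs; have sS := spanm_subspace (fun _ : 'I_1 => s) sR.
split=> // [x0 x1 h0 h1 [c Rx]|x y [c Rx]]; last first.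
  apply: sub_spanm => //; rewrite big_ord1 in Rx.
  have /(bR _ y) := Rx; rewrite -scaleN1r brDl !brZl.
  by apply: subspaceDl => //; do 2 apply: subspaceZ => //.
rewrite big_ord1 in Rx.
have hcs : homog F i (c ord0 *: s) by apply: subspaceZ hs; apply: lsa_homog_subspace.
case: i hs hcs => hs hcs.
  rewrite -addrA in Rx; have [R0 R1] := gR _ _ h0 (homogB h1 hcs) Rx.
  split; first exact: sub_spanm.
  by exists c; rewrite big_ord1.
rewrite addrAC in Rx; have [R0 R1] := gR _ _ (homogB h0 hcs) h1 Rx.
split; last exact: sub_spanm.
by exists c; rewrite big_ord1.
Qed.

End GradedSubspaces.

(** * Spanning sets of double commutators *)

Section Spanning.
Variables (K : fieldType) (F : lieSuperalgebra K).
Implicit Types (A B D R X : set F) (x y z : F).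

Lemma derived_br x y : derived F (x ∙ y).
Proof. exact: mem_br_set. Qed.

(** As D lies in [F, F] + R, the map (y, z) |-> [[s, y], z] vanishes modulo
    [[R, F], F] as soon as y or z is in D: for y because [s, [F, F]] lies in
    [R, F], for z because [s, y] is both in R and in [F, F]. *)
Lemma double_br_adjoin_span D R s t (v : 'I_t -> F) X :
  is_ideal R -> (forall x, D x -> exists2 f, derived F f & R (x - f)) ->
  setT `<=` spanm D v -> homogeneous s -> derived F s -> (forall y, R (s ∙ y)) ->
  is_subspace X -> double_br R `<=` X -> (forall i j, X (s ∙ v i ∙ v j)) ->
  double_br (adjoin R s) `<=` X.
Proof.
move=> iR hD sv hs Ds Rs sX RX Xv; have [sR gR _] := iR.
pose Y := [set y | br_set R setT (s ∙ y)].
have sY : is_subspace Y by apply: br_preimr; apply: br_set_subspace.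
have YD : D `<=` Y.
  move=> x /hD[f Df Rxf]; rewrite -(subrK f x); apply: (subspaceD sY).
    exact: br_setT_mem_sym.
  move: f Df {Rxf}; apply: br_set_min_homog => // y z hy hz _ _.
  by apply: (brAr_mem (br_set_subspace R setT)) => //; apply: mem_br_set.
have Xsl y z : Y y -> X (s ∙ y ∙ z).
  by move=> Yy; apply: RX; apply: mem_br_set.
have Xsr y z : D z -> X (s ∙ y ∙ z).
  move=> /hD[f Df Rxf]; rewrite -(subrK f z) brDr; apply: RX.
  apply: (subspaceD (double_br_subspace R)); last exact: double_br_derived.
  by apply: derived_double_br => //; apply: derived_br.
suff Xs y z : X (s ∙ y ∙ z) by apply: double_br_spanm_sub.
suff : spanm D v `<=` [set y | X (s ∙ y ∙ z)] by apply; apply: sv.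
apply: spanm_min => [|x /YD Yx|i]; last 2 first.
- exact: Xsl.
- suff : spanm D v `<=` [set z | X (s ∙ v i ∙ z)] by apply; apply: sv.
  by apply: spanm_min => [|x Dx|j] /=; [apply: br_preimr | apply: Xsr | apply: Xv].
exact: (preim_subspace (fun a u v => lsa_br_linr a u v s) (br_preiml z sX)).
Qed.

Hypothesis char2 : (2%:R : K) != 0.

Lemma br_even_sq x : homog F false x -> x ∙ x = 0.
Proof.
move=> hx; have /eqP := lsa_skew hx hx; rewrite expr0 scale1r -addr_eq0.
by rewrite -mulr2n -scaler_nat scaler_eq0 (negPf char2) => /eqP.
Qed.

(** For odd x this is the cube axiom, which in characteristic 3 is not a
    consequence of Jacobi. *)
Lemma br_sq_cube x : homogeneous x -> x ∙ x ∙ x = 0.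
Proof.
move=> [[] hx]; last by rewrite br_even_sq // br0l.
by rewrite (lsa_skew (lsa_br_homog hx hx) hx) lsa_cube // scaler0 oppr0.
Qed.

(** The trilinear map [[x, y], z] vanishes modulo [[S, F], F] when one argument
    is in S, so only basis triples matter.  Skew symmetry allows i < j; if then
    k < i, Jacobi rewrites [[v_i, v_j], v_k] by Hall commutators starting with
    v_k.  A repeated index in the inner bracket costs nothing: for k <> i Jacobi
    gives [[v_i, v_i], v_k] from [[v_i, v_k], v_i]. *)
Lemma lcs2_hall_span S t (v : 'I_t -> F) X :
  is_ideal S -> derived F `<=` S -> setT `<=` spanm S v ->
  (forall i, homogeneous (v i)) -> is_subspace X -> double_br S `<=` X ->
  (forall p q r : 'I_t, (p < q)%N -> (p <= r)%N -> X (v p ∙ v q ∙ v r)) ->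
  double_br setT `<=` X.
Proof.
move=> iS DS sv hv sX SX Xhall; have [sS gS _] := iS.
have skew i j k : X (v i ∙ v j ∙ v k) -> X (v j ∙ v i ∙ v k).
  exact: (brC_mem (br_preiml _ sX)).
have X3 i j k : i != j -> X (v i ∙ v j ∙ v k).
  wlog lt_ij : i j / (i < j)%N.
    move=> H ne_ij; case: (ltngtP i j) => [lt_ij|lt_ji|/val_inj eq_ij].
    - exact: H.
    - by apply: skew; apply: H; rewrite // eq_sym.
    - by rewrite eq_ij eqxx in ne_ij.
  move=> _; case: (leqP i k) => [le_ik|lt_ki]; first exact: Xhall.
  have hjk := homogeneous_br (hv j) (hv k).
  apply: (brA_mem sX) => //.
    apply: (brC_mem sX) => //; apply: skew.
    by apply: Xhall; [apply: ltn_trans lt_ij | apply: ltnW].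
  by apply: skew; apply: Xhall => //; apply: ltnW (ltn_trans lt_ki lt_ij).
have Xall i j k : X (v i ∙ v j ∙ v k).
  have [<-|/X3 //] := eqVneq i j.
  have [<-|ne_ik] := eqVneq i k; first by rewrite br_sq_cube //; apply: subspace0.
  apply: (brA_mem sX) => //; last exact: X3.
  by apply: (brC_mem sX) => //; [apply: homogeneous_br | apply: skew; apply: X3; rewrite // eq_sym].
suff X1 x y z : X (x ∙ y ∙ z).
  apply: br_set_min => // u z Du _; move: u Du.
  by apply: br_set_min => [|x y _ _]; [apply: br_preiml | apply: X1].
suff : spanm S v `<=` [set x | X (x ∙ y ∙ z)] by apply; apply: sv.
apply: spanm_min => [|u Su|i].
- exact: (preim_subspace (fun a u v => lsa_br_linl a u v y) (br_preiml z sX)).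
- by apply: SX; apply: mem_double_br.
suff : spanm S v `<=` [set y | X (v i ∙ y ∙ z)] by apply; apply: sv.
apply: spanm_min => [|u Su|j].
- exact: (preim_subspace (fun a u w => lsa_br_linr a u w (v i)) (br_preiml z sX)).
- by apply: SX; apply: mem_br_set => //; apply: br_setT_mem_sym.
suff : spanm S v `<=` [set z | X (v i ∙ v j ∙ z)] by apply; apply: sv.
apply: spanm_min => [|u Su|k].
- exact: br_preimr.
- by apply: SX; apply: derived_double_br => //; apply: derived_br.
- exact: Xall.
Qed.


Section DerivedLine.
Variable R : set F.
Hypothesis iR : is_ideal R.
Let sR : is_subspace R. Proof. by case: iR. Qed.
Let gR : graded R. Proof. by case: iR. Qed.
Let sRF := br_set_subspace R setT.
Let sRFF := double_br_subspace R.

Lemma adjoin_exchange s z : adjoin R s z -> ~ R z -> adjoin R s `<=` adjoin R z.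
Proof.
have sz := spanm_subspace (fun _ : 'I_1 => z) sR.
move=> [c]; rewrite big_ord1 => Rz nRz.
apply: spanm_min => // [|_]; first exact: sub_spanm.
have c0 : c ord0 != 0.
  by apply: contra_notN nRz => /eqP c0; rewrite c0 scale0r subr0 in Rz.
apply: (subspaceZI sz c0); rewrite -[_ *: _](subKr z).
apply: (subspaceB sz); last exact: sub_spanm.
by apply: (mem_spanm (fun=> z) ord0).
Qed.

Lemma double_br_adjoin_trivial z : (forall y, homogeneous y -> br_set R setT (z ∙ y)) ->
  double_br (adjoin R z) `<=` double_br R.
Proof.
by move=> Bz; apply: double_br_spanm_sub => // y w hy hw; apply: mem_br_set => //; apply: Bz.
Qed.

Section Line.
Variable z : F.
Hypothesis Dz : derived F z.
Hypothesis hz : homogeneous z.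
Hypothesis DRz : derived F `<=` adjoin R z.

Lemma derived_line_mem X c : is_subspace X -> R `<=` X -> X z -> derived F c -> X c.
Proof. by move=> sX RX Xz /DRz; apply: spanm_min. Qed.

(** Here [z, a] = 0 by the cube axiom, and Jacobi expresses [z, y] = [[a, a], y]
    through [a, [a, y]] and [[a, y], a], where [a, y] is a multiple of z modulo R. *)
Lemma br_odd_sq_trivial a : homog F true a -> z = a ∙ a ->
  double_br (adjoin R z) `<=` double_br R.
Proof.
move=> ha ez; have ha' : homogeneous a by exists true.
have za : z ∙ a = 0 by rewrite ez br_sq_cube.
apply: double_br_adjoin_trivial => y hy; rewrite ez.
apply: (brA_mem sRF) => //.
  apply: (derived_line_mem (br_preimr a sRF)) (derived_br _ _) => /= [u Ru|].
    exact: br_setT_mem_sym.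
  by rewrite ez lsa_cube //; apply: subspace0.
apply: (derived_line_mem (br_preiml a sRF)) (derived_br _ _) => /= [u Ru|].
  exact: mem_br_set.
by rewrite za; apply: subspace0.
Qed.

Section Plane.
Variables a b : F.
Hypotheses (ha : homogeneous a) (hb : homogeneous b) (ez : z = a ∙ b).

(** Jacobi on [[a, b], c], where [b, c] and [a, c] are multiples of z modulo R. *)
Lemma br_line_span X c : is_subspace X -> br_set R setT `<=` X ->
  X (z ∙ a) -> X (z ∙ b) -> homogeneous c -> X (z ∙ c).
Proof.
move=> sX RX Xza Xzb hc; rewrite ez; apply: (brA_mem sX) => //.
  apply: (derived_line_mem (br_preimr a sX)) (derived_br _ _) => /= [u Ru|].
    by apply: RX; apply: br_setT_mem_sym.
  exact: (brC_mem sX).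
apply: (derived_line_mem (br_preiml b sX)) (derived_br _ _) => //= u Ru.
by apply: RX; apply: mem_br_set.
Qed.

(** By [br_line_span] the first entry of [[z, y], w] may be taken to be a or b;
    swapping y and w costs [z, [y, w]], a multiple of [z, z] modulo
    [[R, F], F], after which w can be reduced as well. *)
Lemma double_br_line_span X : is_subspace X -> double_br R `<=` X ->
  X (z ∙ a ∙ a) -> X (z ∙ b ∙ a) -> X (z ∙ a ∙ b) -> X (z ∙ b ∙ b) ->
  double_br (adjoin R z) `<=` X.
Proof.
move=> sX RX Xaa Xba Xab Xbb.
have BX w u : br_set R setT u -> X (u ∙ w) by move=> Bu; apply: RX; apply: mem_br_set.
have Xzz : X (z ∙ z) by rewrite {2}ez; apply: (brAr_mem sX).
have Xz c w : homogeneous c -> homogeneous w -> X (z ∙ w ∙ c) -> X (z ∙ c ∙ w).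
  move=> hc hw Xwc; apply: (brA_mem sX) => //.
  apply: (derived_line_mem (br_preimr z sX)) (derived_br _ _) => //= u Ru.
  by apply: RX; apply: derived_double_br.
apply: double_br_spanm_sub => // y w hy hw.
apply: (br_line_span (br_preiml w sX)) => //= [u Bu||]; first exact: BX.
  by apply: Xz => //; apply: (br_line_span (br_preiml a sX)) => //= u Bu; apply: BX.
by apply: Xz => //; apply: (br_line_span (br_preiml b sX)) => //= u Bu; apply: BX.
Qed.

End Plane.
End Line.

(** When [a, b] spans [F, F] modulo R, this says that the bracket, seen as a
    bilinear form modulo R, has rank 2. *)
Definition perp_abelian a b := forall c d, homogeneous c -> homogeneous d ->
  R (a ∙ c) -> R (b ∙ c) -> R (a ∙ d) -> R (b ∙ d) -> R (c ∙ d).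

(** The choice of z = [a, b] is by parity: an odd a with [a, a] outside R if there
    is one, otherwise a even and b odd, otherwise both even.  In the second case
    [[b, b], a] = -2 [z, b] puts [z, b] in [R, F].  In the third, if c and d are
    orthogonal to a and b with [c, d] outside R, then z is a multiple of [c, d]
    modulo R, and Jacobi gives [z, a], [z, b] in [R, F]. *)
Lemma derived_line_cases s : derived F `<=` adjoin R s -> ~ derived F `<=` R ->
  exists z, [/\ homogeneous z, derived F z, ~ R z, adjoin R s `<=` adjoin R z &
    (exists e : 'I_2 -> F, double_br (adjoin R z) `<=` spanm (double_br R) e) \/
    (exists a b, [/\ homog F false a, homog F false b, z = a ∙ b, perp_abelian a b &
      exists e : 'I_3 -> F, double_br (adjoin R z) `<=` spanm (double_br R) e])].
Proof.
move=> DRs nDR.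
have line z : derived F z -> ~ R z -> adjoin R s `<=` adjoin R z.
  by move=> /DRs; apply: adjoin_exchange.
have Dline z (Dz : derived F z) (nz : ~ R z) := subset_trans DRs (line z Dz nz).
have trivial2 z : double_br (adjoin R z) `<=` double_br R ->
    exists e : 'I_2 -> F, double_br (adjoin R z) `<=` spanm (double_br R) e.
  by move=> zR; exists (fun=> 0); apply: subset_trans zR _; apply: sub_spanm.
have [[a [ha nRa]]|oddsq] := pselect (exists a, homog F true a /\ ~ R (a ∙ a)).
  have Da := derived_br a a; have Dla := Dline _ Da nRa.
  exists (a ∙ a); split=> //; first by apply: homogeneous_br; exists true.
    exact: line.
  by left; apply: trivial2; apply: br_odd_sq_trivial ha _.
have {}oddsq a : homog F true a -> R (a ∙ a).
  by move=> ha; apply: contrapT => nRa; apply: oddsq; exists a.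
have oddodd a b : homog F true a -> homog F true b -> R (a ∙ b).
  move=> ha hb; have hab : homog F true (a + b).
    by apply: subspaceD => //; apply: lsa_homog_subspace.
  have := oddsq _ hab; rewrite brDl !brDr addrA.
  move=> /(subspaceDl sR (oddsq _ hb)); rewrite -addrA addrC.
  move=> /(subspaceDl sR (oddsq _ ha)).
  rewrite [b ∙ a](lsa_skew hb ha) scaleN1r opprK -mulr2n -scaler_nat.
  exact: subspaceZI.
have [[a [b [ha hb nRab]]]|evenodd] :=
    pselect (exists a b, [/\ homog F false a, homog F true b & ~ R (a ∙ b)]).
  have ha' : homogeneous a by exists false.
  have hb' : homogeneous b by exists true.
  have Dab := derived_br a b; have Dl := Dline _ Dab nRab.
  exists (a ∙ b); split=> //; [exact: homogeneous_br | exact: line | left].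
  pose z := a ∙ b; have hz : homog F true z by apply: (lsa_br_homog ha hb).
  have Bzb : br_set R setT (z ∙ b).
    have : br_set R setT (b ∙ b ∙ a) by apply: mem_br_set => //; apply: oddsq.
    rewrite (brA hb hb ha) /= expr0 scale1r (lsa_skew hb ha) /= expr0 scale1r.
    rewrite brNr brNl (lsa_skew hb hz) /=.
    rewrite expr1 scaleN1r opprK -/z -opprD -mulr2n -scaler_nat => /(subspaceN sRF).
    by rewrite opprK; apply: subspaceZI.
  have Rzb w : double_br R (z ∙ b ∙ w) by apply: mem_br_set.
  pose e (i : 'I_2) := if i == ord0 then z ∙ a ∙ a else z ∙ a ∙ b.
  have sX := spanm_subspace e sRFF; have RX := sub_spanm e sRFF.
  exists e; apply: (double_br_line_span (z := z) _ _ Dl ha' hb') => //.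
  - exact: homogeneous_br.
  - exact: (mem_spanm e ord0).
  - exact: RX.
  - exact: (mem_spanm e (lift ord0 ord0)).
  - exact: RX.
have [a [b [ha hb nRab]]] : exists a b, [/\ homog F false a, homog F false b & ~ R (a ∙ b)].
  apply: contrapT => evens; apply: nDR.
  apply: br_set_min_homog => // x y [[] hx] [[] hy] _ _; first exact: oddodd.
  - apply: (brC_mem sR); [by exists false | by exists true | apply: contrapT => nR].
    by apply: evenodd; exists y, x.
  - by apply: contrapT => nR; apply: evenodd; exists x, y.
  - by apply: contrapT => nR; apply: evens; exists x, y.
have ha' : homogeneous a by exists false.
have hb' : homogeneous b by exists false.
have Dab := derived_br a b; have Dl := Dline _ Dab nRab.
pose z := a ∙ b; have hz : homog F false z by apply: (lsa_br_homog ha hb).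
have hz' : homogeneous z by exists false.
exists z; split=> //; first exact: line.
have [perp|/existsNP[c /existsNP[d nperp]]] := pselect (perp_abelian a b).
  right; exists a, b; split=> //.
  pose e (i : 'I_3) := if i == 0 :> nat then z ∙ a ∙ a else
                       if i == 1 :> nat then z ∙ a ∙ b else z ∙ b ∙ b.
  have sX := spanm_subspace e sRFF.
  have Xab : spanm (double_br R) e (z ∙ a ∙ b) by exact: (mem_spanm e (@Ordinal 3 1 isT)).
  exists e; apply: (double_br_line_span (z := z) _ _ Dl ha' hb') => //.
  - exact: sub_spanm.
  - exact: (mem_spanm e (@Ordinal 3 0 isT)).
  - apply: (brA_mem sX) => //.
    by rewrite (lsa_skew hb ha) scale1r brNr br_even_sq // oppr0; apply: subspace0.
  - exact: (mem_spanm e (@Ordinal 3 2 isT)).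
left; apply: trivial2.
have {nperp}[hc hd Rac Rbc [Rad [Rbd nRcd]]] : [/\ homogeneous c, homogeneous d,
    R (a ∙ c), R (b ∙ c) & R (a ∙ d) /\ (R (b ∙ d) /\ ~ R (c ∙ d))].
  move: nperp => /not_implyP[hc /not_implyP[hd /not_implyP[Rac /not_implyP[Rbc]]]].
  by move=> /not_implyP[Rad /not_implyP[Rbd nRcd]].
have Dcd := Dline _ (derived_br c d) nRcd.
have Bz u : homogeneous u -> R (u ∙ c) -> R (u ∙ d) -> br_set R setT (z ∙ u).
  move=> hu Ruc Rud; apply: (derived_line_mem Dcd (br_preiml u sRF)) Dab => /= [r Rr|].
    exact: mem_br_set.
  apply: (brA_mem sRF) => //; last by apply: mem_br_set => //; apply: (brC_mem sR).
  by apply: br_setT_mem_sym => //; apply: (brC_mem sR).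
apply: double_br_adjoin_trivial => y hy.
by apply: (br_line_span hz' Dl ha' hb' (erefl _) sRF) => //; apply: Bz.
Qed.
End DerivedLine.

End Spanning.

(** * The upper bound *)

(** Indices (p, q, r) of the basic commutators [[v_p, v_q], v_r]. *)
Definition hall t :=
  {x : 'I_t * 'I_t * 'I_t | ((x.1.1 < x.1.2) && (x.1.1 <= x.2))%N}.

(** For a fixed first index p = t - 1 - i there are i choices of q > p and i + 1
    choices of r >= p. *)
Lemma card_hall t : (3 * #|{: hall t}| + t = t ^ 3)%N.
Proof.
have -> : #|{: hall t}| = (\sum_(i < t) i * i.+1)%N.
  rewrite card_sig -sum1_card.
  rewrite (eq_bigl (fun x : 'I_t * 'I_t * 'I_t => (x.1.1 < x.1.2) && (x.1.1 <= x.2))%N) //.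
  transitivity (\sum_(p < t) \sum_(q < t | (p < q)%N) \sum_(r < t | (p <= r)%N) 1)%N.
    by rewrite pair_big_dep pair_big_dep; apply: eq_bigl => -[[p q] r].
  rewrite (reindex_inj rev_ord_inj) /=; apply: eq_bigr => i _.
  have lt_it := ltn_ord i.
  have cnt (m : nat) : (m <= t)%N -> (\sum_(r < t | (m <= r)%N) 1 = t - m)%N.
    move=> le_mt; rewrite -(big_mkord (fun r => m <= r)%N (fun=> 1%N)).
    rewrite (big_cat_nat (n := m)) //= big_nat_cond big_pred0 => [|r]; last first.
      by apply/negbTE/negP => /andP[/andP[_ ?] ?]; lia.
    rewrite add0n big_nat_cond (eq_bigl (fun r => m <= r < t)%N) => [|r]; last lia.
    by rewrite -big_nat sum_nat_const_nat muln1.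
  rewrite sum_nat_const -sum1_card !cnt; [|lia..].
  by congr (_ * _)%N; lia.
elim: t => [|t IHt]; first by rewrite big_ord0.
rewrite big_ord_recr /= mulnDr; move: IHt; rewrite !expnS !expn0 !muln1.
move: (\sum_(i < t) _)%N => S e; nia.
Qed.

Section UpperBound.
Variables (K : fieldType) (F : lieSuperalgebra K).
Hypothesis char2 : (2%:R : K) != 0.
Implicit Types (R X : set F) (x y z : F).

(** The last term of the lower central series of F not contained in R has a
    homogeneous element outside R, and its brackets are in the next term. *)
Lemma exists_central_modulo R : is_ideal R -> (exists n, lcs F n `<=` R) ->
  ~ derived F `<=` R ->
  exists s, [/\ homogeneous s, derived F s, ~ R s & forall y, R (s ∙ y)].
Proof.
move=> iR exn nDR.
have exn' : exists n, `[< lcs F n `<=` R >] by case: exn => n nR; exists n; apply/asboolP.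
case: (ex_minnP exn') => -[|[|n]] /asboolP nR minn.
- by case: nDR => x _; apply: nR.
- by [].
have /existsNP[x /not_implyP[Lx nRx]] : ~ (lcs F n.+1 `<=` R).
  by move=> /asboolP/minn; rewrite ltnn.
apply: contrapT => nos; apply: nRx; move: x Lx.
apply: graded_sub; [by case: (lcs_ideal F n.+1) | by case: iR | move=> x hx Lx].
apply: contrapT => nRx; apply: nos; exists x; split=> //.
  exact: (lcs_sub_derived Lx).
by move=> y; apply: nR; apply: mem_br_set.
Qed.

Variables (D : set F) (t : nat) (v : 'I_t -> F).
Hypotheses (iD : is_ideal D) (DD : derived F `<=` D).
Hypotheses (hv : forall i, homogeneous (v i)) (sv : setT `<=` spanm D v).

Definition hall_br (x : hall t) : F := v (val x).1.1 ∙ v (val x).1.2 ∙ v (val x).2.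

Lemma lcs2_spanm S : is_ideal S -> D `<=` S -> double_br setT `<=` spanm (double_br S) hall_br.
Proof.
move=> iS DS; have sS := double_br_subspace S.
apply: (lcs2_hall_span char2 iS (subset_trans DD DS) _ hv (spanm_subspace _ sS)).
- by apply: subset_trans sv _ => x [c Dc]; exists c; apply: DS.
- exact: sub_spanm.
- move=> p q r pq pr; have pqr : ((p < q) && (p <= r))%N by rewrite pq.
  exact: (mem_spanm hall_br (exist _ (p, q, r) pqr) sS).
Qed.

Section Relations.
Variable R : set F.
Hypotheses (iR : is_ideal R) (RD : R `<=` D).
Hypothesis DR : forall x, D x -> exists2 f, derived F f & R (x - f).
Hypothesis nilR : exists n, lcs F n `<=` R.

Lemma derived_not_sub d : quot_dim D R d.+1 -> ~ derived F `<=` R.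
Proof.
move=> [e [De _ ie]] DR'.
have Re : R (e ord0).
  have [f Df Ref] := DR (De ord0); rewrite -(subrK f (e ord0)).
  by apply: (subspaceD (ideal_subspace iR)) => //; apply: DR'.
have /(_ (fun i => (i == ord0)%:R)) := ie; rewrite (bigD1 ord0) //= scale1r big1.
  by rewrite addr0 => /(_ Re ord0)/eqP; rewrite eqxx oner_eq0.
by move=> i /negPf ->; rewrite scale0r.
Qed.

Lemma exists_central_adjoin d : quot_dim D R d.+1 -> exists s,
  [/\ homogeneous s, derived F s, ~ R s, forall y, R (s ∙ y) & quot_dim D (adjoin R s) d].
Proof.
move=> Dd; have [s [hs Ds nRs Rs]] := exists_central_modulo iR nilR (derived_not_sub Dd).
exists s; split=> //.
have [sR _ _] := iR; have [sD _ _] := iD.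
by have [d' Dd' [->]] := quot_dim_exchange sR sD RD (DD Ds) nRs Dd.
Qed.

(** The first step of the induction in [mult2_upper], kept separate because the
    case of equality depends on which alternative holds. *)
Lemma lcs2_line_bound : quot_dim D R 1 ->
  (exists e : hall t + 'I_2 -> F, double_br setT `<=` spanm (double_br R) e) \/
  ((exists a b, [/\ homog F false a, homog F false b, ~ R (a ∙ b) & perp_abelian R a b])
   /\ exists e : hall t + 'I_3 -> F, double_br setT `<=` spanm (double_br R) e).
Proof.
move=> D1; have [s [hs Ds nRs Rs D0]] := exists_central_adjoin D1.
have Dsub : D `<=` adjoin R s.
  by case: D0 => e [_ se _] x /se[c]; rewrite big_ord0 subr0.
have sR := ideal_subspace iR.
have Rder c y : derived F c -> R (c ∙ y).
  move=> /DD/Dsub; suff : adjoin R s `<=` [set c | R (c ∙ y)] by apply.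
  by apply: spanm_min => [|r Rr|_] /=; [apply: br_preiml | apply: ideal_br | apply: Rs].
have [z [hz Dz nRz sz cases]] :=
  derived_line_cases char2 iR (subset_trans DD Dsub) (derived_not_sub D1).
have iz : is_ideal (adjoin R z) by apply: spanm_ideal => // y; apply: Rder.
have F3 := lcs2_spanm iz (subset_trans Dsub sz).
case: cases => [[e He]|[a [b [ha hb ez perp [e He]]]]].
  by left; apply: spanm_trans F3 He; apply: double_br_subspace.
right; split; last by apply: spanm_trans F3 He; apply: double_br_subspace.
by exists a, b; split; rewrite -?ez.
Qed.

End Relations.

(** As D stays fixed while R grows, every step can use the same v_i and costs the
    same t². *)
Lemma mult2_upper m R : is_ideal R -> R `<=` D ->
  (forall x, D x -> exists2 f, derived F f & R (x - f)) ->
  (exists n, lcs F n `<=` R) -> quot_dim D R m.+1 ->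
  exists (T : finType) (e : T -> F), R `&` double_br setT `<=` spanm (double_br R) e /\
    #|T| = (#|{: hall t}| + m * t ^ 2 + 3)%N.
Proof.
elim: m R => [|m IHm] R iR RD DR nilR Dm.
  case: (lcs2_line_bound iR RD DR nilR Dm) => [[e He]|[_ [e He]]].
    exists (hall t + 'I_2 + 'I_1)%type, (fun i => if i is inl i then e i else 0).
    split; last by rewrite !card_sum !card_ord mul0n addn0 -addnA.
    move=> x [_ /He[c Rc]]; exists (fun i => if i is inl i then c i else 0).
    by rewrite big_sumType /= [X in _ - (_ + X)]big1 ?addr0 // => i _; rewrite scaler0.
  exists (hall t + 'I_3)%type, e; split; last by rewrite card_sum card_ord mul0n addn0.
  exact: subset_trans (@subIsetr _ _ _) He.
have [s [hs Ds nRs Rs D']] := exists_central_adjoin iR RD DR nilR Dm.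
have iS := spanm_ideal iR hs Rs; have sR := ideal_subspace iR.
have RS := sub_spanm (fun _ : 'I_1 => s) sR.
have [|||T [e [He cardT]]] := IHm _ iS _ _ _ D'.
- by apply: spanm_min => // [|_]; [case: iD | apply: DD].
- by move=> x /DR[f Df Rf]; exists f => //; apply: RS.
- by case: nilR => n nR; exists n; apply: subset_trans nR RS.
have sRR := double_br_subspace R.
pose e2 (ij : 'I_t * 'I_t) := s ∙ v ij.1 ∙ v ij.2.
have He2 : double_br (adjoin R s) `<=` spanm (double_br R) e2.
  apply: (double_br_adjoin_span iR DR sv hs Ds Rs (spanm_subspace _ sRR)) => [|i j].
    exact: sub_spanm.
  exact: (mem_spanm e2 (i, j)).
have [f Hf] := spanm_trans sRR He He2.
exists (T + 'I_t * 'I_t)%type, f; split; last first.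
  by rewrite card_sum card_prod card_ord cardT; lia.
by move=> x [Rx F3x]; apply: Hf; split=> //; apply: RS.
Qed.

End UpperBound.

(** * From a presentation to the ideals of the free algebra *)

Section GradedDimension.
Variables (K : fieldType) (L : lieSuperalgebra K).

Lemma graded_has_dim (A : set L) r s : graded A -> is_subspace A ->
  has_sdim A r s -> has_dim A (r + s).
Proof.
move=> gA sA [[e [Ae se ie]] [f [Af sf jf]]].
pose g (i : 'I_r + 'I_s) := match i with inl i => e i | inr i => f i end.
rewrite -[r]card_ord -[s]card_ord -card_sum.
apply: (@quot_dim_fin _ _ _ _ _ g).
- by case=> i /=; [case: (Ae i) | case: (Af i)].
- move=> x /(gradedP gA)[x0 [x1 [h0 h1 A0 A1 ->]]].
  have [c /= e0] := se _ (conj A0 h0); have [d /= e1] := sf _ (conj A1 h1).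
  exists (fun i : 'I_r + 'I_s => match i with inl i => c i | inr i => d i end).
  by rewrite big_sumType /= opprD addrACA e0 e1 addr0.
- move=> c; rewrite big_sumType /= => /eqP; rewrite addr_eq0 => /eqP e0.
  pose w := \sum_i c (inl i) *: e i; have sH := lsa_homog_subspace L.
  have h0 : homog L false w.
    by apply: (subspace_sum _ (sH false)) => i; apply: (subspaceZ _ (sH false)); case: (Ae i).
  have h1 : homog L true w.
    rewrite /w e0; apply: subspaceN; first exact: lsa_homog_subspace.
    by apply: (subspace_sum _ (sH true)) => i; apply: (subspaceZ _ (sH true)); case: (Af i).
  have w0 := lsa_homog_cap h0 h1; rewrite /w in w0.
  have c0 := ie (c \o inl) w0.
  have d0 : forall i, (c \o inr) i = 0.
    by apply: jf; apply/eqP; rewrite /= -oppr_eq0 -e0 w0.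
  by case=> i; [apply: c0 | apply: d0].
Qed.

(** Hall commutators need homogeneous v_i, so the basis is chosen in each parity
    separately. *)
Lemma homogeneous_complement (A : set L) k l r s : graded A -> is_subspace A ->
  @has_sdim K L setT k l -> has_sdim A r s ->
  exists t (v : 'I_t -> L), [/\ forall i, homogeneous (v i), setT `<=` spanm A v
    & (t + (r + s) = k + l)%N].
Proof.
move=> gA sA; rewrite /has_sdim !setTI => -[Hk Hl] [Ar As].
have sH := lsa_homog_subspace L; have s0 := @subspace_zero K L.
have sub p : [set 0] `<=` A `&` homog L p.
  by move=> _ ->; split; apply: subspace0.
have [t0 [e [He se _]] ->] :=
  quot_dim_sub s0 (subspaceI sA (sH false)) (sub false) (@subIsetr _ _ _) Hk Ar.
have [t1 [f [Hf sf _]] ->] :=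
  quot_dim_sub s0 (subspaceI sA (sH true)) (sub true) (@subIsetr _ _ _) Hl As.
pose v i := match split i with inl i => e i | inr i => f i end.
exists (t0 + t1)%N, v; split; last by lia.
  by move=> i; rewrite /v; case: split => j; [exists false | exists true].
move=> x _; have [x0 [x1 [h0 h1 ->]]] := lsa_homog_sum x.
have [c [Ac _]] := se _ h0; have [d [Ad _]] := sf _ h1.
exists (fun i => match split i with inl i => c i | inr i => d i end).
rewrite big_split_ord /= /v.
under eq_bigr => i _ do rewrite (unsplitK (inl _ i)).
under [X in _ - (_ + X)]eq_bigr => i _ do rewrite (unsplitK (inr _ i)).
by rewrite opprD addrACA; apply: subspaceD.
Qed.

End GradedDimension.

Section Kernel.
Variables (K : fieldType) (F L : lieSuperalgebra K) (f : F -> L).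
Hypothesis hf : lsa_hom f.

Lemma hom_lin (a : K) (x y : F) : f (a *: x + y) = a *: f x + f y.
Proof. by case: hf. Qed.
Lemma hom_homog i x : homog F i x -> homog L i (f x).
Proof. by case: hf => _ h _; apply: h. Qed.
Lemma hom_br x y : f (x ∙ y) = f x ∙ f y.
Proof. by case: hf. Qed.

Lemma graded_preim (A : set L) : graded A -> graded [set x | A (f x)].
Proof.
move=> gA x0 x1 h0 h1 /=; rewrite (linD hom_lin) => /gA.
by apply; apply: hom_homog.
Qed.

Lemma ideal_preim (A : set L) : is_ideal A -> is_ideal [set x | A (f x)].
Proof.
case=> sA gA bA; split; first exact: (preim_subspace hom_lin).
  exact: graded_preim.
by move=> x y /= Ax; rewrite hom_br; apply: bA.
Qed.

Lemma ideal0 : is_ideal ([set 0] : set L).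
Proof.
split; first exact: subspace_zero.
  move=> x0 x1 h0 h1 /= e; have s0 := lsa_homog_subspace L.
  have e' : x0 + x1 = 0 + 0 by rewrite addr0.
  by have [-> ->] := homog_sum_inj h0 h1 (subspace0 (s0 false)) (subspace0 (s0 true)) e'.
by move=> x y ->; rewrite /= br0l.
Qed.

Lemma hom_br_set A B A' B' : (forall x, A x -> A' (f x)) -> (forall x, B x -> B' (f x)) ->
  forall x, br_set A B x -> br_set A' B' (f x).
Proof.
move=> AA' BB' x ABx; suff : br_set A B `<=` [set x | br_set A' B' (f x)] by apply.
apply: br_set_min => [|a b Aa Bb].
  exact/(preim_subspace hom_lin)/br_set_subspace.
by rewrite /= hom_br; apply: mem_br_set; [apply: AA' | apply: BB'].
Qed.

Lemma hom_lcs n x : lcs F n x -> lcs L n (f x).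
Proof. by elim: n x => [//|n IHn]; apply: hom_br_set. Qed.

Hypothesis f_surj : forall y, exists x, f x = y.

Lemma homog_lift i y : homog L i y -> exists2 x, homog F i x & f x = y.
Proof.
move=> hy; have [x fx] := f_surj y; have [x0 [x1 [h0 h1 ex]]] := lsa_homog_sum x.
have [hf0 hf1] := (hom_homog h0, hom_homog h1); have s0 := lsa_homog_subspace L.
have e : f x0 + f x1 = y by rewrite -(linD hom_lin) -ex.
case: i hy => hy; [exists x1 | exists x0] => //.
  by rewrite -[y]add0r in e; have [] := homog_sum_inj hf0 hf1 (subspace0 (s0 false)) hy e.
by rewrite -[y]addr0 in e; have [] := homog_sum_inj hf0 hf1 hy (subspace0 (s0 true)) e.
Qed.

Lemma derived_lift y : derived L y -> exists2 x, derived F x & f x = y.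
Proof.
suff : derived L `<=` [set y | exists2 x, derived F x & f x = y] by apply.
apply: br_set_min => [|a b _ _].
  split=> [|a _ _ [x Dx <-] [y' Dy <-]].
    by exists 0; [apply: subspace0; case: (derived_ideal F) | apply: (lin0 hom_lin)].
  exists (a *: x + y'); last exact: hom_lin.
  by have [[_ sF] _ _] := derived_ideal F; apply: sF.
have [[x <-] [x' <-]] := (f_surj a, f_surj b).
by exists (x ∙ x'); [apply: derived_br | rewrite hom_br].
Qed.

End Kernel.

Section Presentation.
Variables (K : fieldType) (L : lieSuperalgebra K) (k l r s : nat).
Hypothesis nilL : lsa_nilpotent L.
Hypotheses (dimL : @has_sdim K L setT k l) (dimL2 : has_sdim (derived L) r s).
Variables (F : lieSuperalgebra K) (f : F -> L).
Hypotheses (hf : lsa_hom f) (f_surj : forall y, exists x, f x = y).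

Definition hker : set F := [set x | f x = 0].

Lemma hker_ideal : is_ideal hker.
Proof. exact: (ideal_preim hf (@ideal0 K L)). Qed.

Lemma hker_nil : exists n, lcs F n `<=` hker.
Proof.
case: nilL => n Ln; exists n => x /(hom_lcs hf); rewrite Ln; exact.
Qed.

(** The preimage of L². *)
Let D : set F := [set x | derived L (f x)].

Lemma presentation_data : exists t (v : 'I_t -> F),
  [/\ forall i, homogeneous (v i), setT `<=` spanm D v, (t + (r + s) = k + l)%N,
      is_ideal D & [/\ derived F `<=` D, hker `<=` D,
      forall x, D x -> exists2 u, derived F u & hker (x - u)
    & quot_dim D hker (r + s)]].
Proof.
have [sL2 gL2 bL2] := derived_ideal L.
have [t [w [hw sw et]]] := homogeneous_complement gL2 sL2 dimL dimL2.
have /choice[v hv] : forall i, exists v, homogeneous v /\ f v = w i.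
  move=> i; have [p hp] := hw i; have [x hx <-] := homog_lift hf f_surj hp.
  by exists x; split=> //; exists p.
have flin := hom_lin hf.
exists t, v; split=> //; first by move=> i; case: (hv i).
- move=> x _; have [c Lc] := sw (f x) I; exists c; rewrite /D /= (linB flin) (lin_sum flin).
  rewrite (eq_bigr (fun i => c i *: w i)) // => i _.
  by rewrite (linZ flin); case: (hv i) => _ ->.
- exact: (ideal_preim hf (derived_ideal L)).
split.
- exact: (hom_lcs hf (n := 1)).
- by move=> x; rewrite /hker /D /= => ->; apply: subspace0.
- move=> x /(derived_lift hf f_surj)[u Du fu]; exists u => //.
  by rewrite /hker /= (linB flin) fu subrr.
- exact: (preim_quot_dim flin f_surj (graded_has_dim gL2 sL2 dimL2)).
Qed.

End Presentation.

(** * Subalgebras, and generation of free Lie superalgebras *)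

Record is_subalgebra (K : fieldType) (F : lieSuperalgebra K) (B : set F) : Prop :=
  IsSubalgebra {
    subalg_subspace : is_subspace B;
    subalg_graded : graded B;
    subalg_br : forall x y, B x -> B y -> B (x ∙ y)
  }.

Section SubSuperalgebra.
Variables (K : fieldType) (F : lieSuperalgebra K) (B : set F).
Hypothesis subB : is_subalgebra B.

(** The proof is an argument so that the closure properties can be found by
    canonical inference. *)
Definition subalg_mem of is_subalgebra B : pred F := fun x => `[< B x >].

Lemma subalg_submod_closed : GRing.subsemimod_closed (subalg_mem subB).
Proof.
have sB := subalg_subspace subB.
split; first split.
- by apply/asboolP; apply: subspace0.
- by move=> x y /asboolP Bx /asboolP By; apply/asboolP; apply: subspaceD.
- by move=> a x /asboolP Bx; apply/asboolP; apply: subspaceZ.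
Qed.

HB.instance Definition _ :=
  GRing.isSubmodClosed.Build K F (subalg_mem subB) subalg_submod_closed.

Definition subalg_type := {x : F | subalg_mem subB x}.
HB.instance Definition _ := SubChoice.on subalg_type.
HB.instance Definition _ := [SubChoice_isSubLmodule of subalg_type by <:].

Lemma subalgP (x : subalg_type) : B (val x).
Proof. exact/asboolP/(valP x). Qed.

Definition to_subalg x (Bx : B x) : subalg_type := exist _ x (introT (asboolP _) Bx).

Definition subalg_lie_br (x y : subalg_type) : subalg_type :=
  to_subalg (subalg_br subB (subalgP x) (subalgP y)).

Definition subalg_homog i : set subalg_type := [set x | homog F i (val x)].

Definition lsa_subalg : lieSuperalgebra K.
Proof.
apply: (@LieSuperalgebra K subalg_type subalg_homog subalg_lie_br).
- move=> i; have sH := lsa_homog_subspace F i.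
  split=> [|a x y hx hy]; first exact: (subspace0 sH).
  exact: (sH.2).
- move=> x; have [x0 [x1 [h0 h1 B0 B1 ex]]] := gradedP (subalg_graded subB) (subalgP x).
  by exists (to_subalg B0), (to_subalg B1); split=> //; apply: val_inj.
- by move=> x h0 h1; apply: val_inj; apply: lsa_homog_cap h0 h1.
- by move=> a x y z; apply: val_inj; rewrite /= lsa_br_linl.
- by move=> a x y z; apply: val_inj; rewrite /= lsa_br_linr.
- by move=> i j x y hx hy; apply: lsa_br_homog.
- by move=> i j x y hx hy; apply: val_inj; rewrite /=; apply: lsa_skew.
- by move=> i j x y z hx hy; apply: val_inj; rewrite /=; apply: lsa_jacobi.
- by move=> x hx; apply: val_inj; apply: lsa_cube.
Defined.

End SubSuperalgebra.

(** The generators lift to a homomorphism from F to the subalgebra B; composed with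
    the inclusion it is the identity, by uniqueness. *)
Lemma free_generated (K : fieldType) (F : lieSuperalgebra K) (X : Type) (p : X -> bool)
    (i : X -> F) (B : set F) :
  is_free_on p i -> is_subalgebra B -> (forall x, B (i x)) -> forall x, B x.
Proof.
move=> [hi freeF] subB Bi x.
pose g y : lsa_subalg subB := to_subalg subB (Bi y).
have [|[phi [hphi phii]] _] := freeF (lsa_subalg subB) g; first exact: hi.
have [_ uniq] := freeF F i hi.
have hval : lsa_hom (fun y => val (phi y) : F).
  have [l h b] := hphi; split=> [a y z|j y hy|y z].
  - by rewrite l.
  - exact: h hy.
  - by rewrite b.
have hid : lsa_hom (fun y : F => y) by [].
have <- : val (phi x) = x.
  by apply: (uniq (fun y => val (phi y)) id hval hid) => // y; rewrite phii.
exact: subalgP.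
Qed.

(** * Graded matrices and their filtration *)

Section GradedMatrices.
Variables (K : fieldType) (n : nat) (par : 'I_n -> bool).
Implicit Types A B C : 'M[K]_n.

Definition gl_proj (p : bool) A : 'M[K]_n :=
  \matrix_(i, j) (if par i (+) par j == p then A i j else 0).

Definition gl_homog (p : bool) : set 'M[K]_n :=
  [set A | forall i j, par i (+) par j != p -> A i j = 0].

(** The supercommutator AB - (-1)^(|A||B|) BA, extended bilinearly: for odd B the
    sign is that of the conjugation which fixes even and negates odd matrices. *)
Definition gl_br A B : 'M[K]_n :=
  A *m B - (gl_proj false B *m A
            + gl_proj true B *m (gl_proj false A - gl_proj true A)).

Lemma gl_proj_sum A : A = gl_proj false A + gl_proj true A.
Proof.
by apply/matrixP => i j; rewrite !mxE; case: (_ (+) _); rewrite /= ?addr0 ?add0r.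
Qed.

Lemma gl_proj_lin p a A B : gl_proj p (a *: A + B) = a *: gl_proj p A + gl_proj p B.
Proof. by apply/matrixP => i j; rewrite !mxE; case: eqP => // _; rewrite mulr0 addr0. Qed.

Lemma gl_proj_homog p A : gl_homog p (gl_proj p A).
Proof. by move=> i j /negPf pij; rewrite mxE pij. Qed.

Lemma gl_proj_id p q A : gl_homog p A -> gl_proj q A = if q == p then A else 0.
Proof.
move=> hA; apply/matrixP => i j; rewrite !mxE; case: (eqVneq q p) => [->|ne_qp].
  by case: eqP => // /eqP ne; rewrite hA.
rewrite mxE; case: eqP => // e; apply: hA; by rewrite e.
Qed.

Lemma gl_br_homogE p q A B : gl_homog p A -> gl_homog q B ->
  gl_br A B = A *m B - (-1) ^+ (p && q) *: (B *m A).
Proof.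
move=> hA hB; rewrite /gl_br !(gl_proj_id _ hA) !(gl_proj_id _ hB).
case: p q hA hB => [] [] _ _ /=;
  rewrite ?mul0mx ?mulmx0 ?sub0r ?subr0 ?add0r ?addr0 ?expr0 ?expr1 ?scale1r ?scaleN1r //.
by rewrite mulmxN.
Qed.

Lemma gl_mul_homog p q A B : gl_homog p A -> gl_homog q B -> gl_homog (p (+) q) (A *m B).
Proof.
move=> hA hB i j ne; rewrite mxE big1 // => k _.
have [e|/hA ->] := eqVneq (par i (+) par k) p; last by rewrite mul0r.
rewrite [B k j]hB ?mulr0 //; apply: contra ne => /eqP <-; rewrite -e.
by case: (par i) (par j) (par k) => [] [] [].
Qed.

Lemma gl_homog_subspace p : is_subspace (gl_homog p).
Proof.
split=> [i j _|a A B hA hB i j ne]; first by rewrite mxE.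
by rewrite !mxE hA // hB // mulr0 addr0.
Qed.

Lemma gl_br_homog p q A B : gl_homog p A -> gl_homog q B -> gl_homog (p (+) q) (gl_br A B).
Proof.
move=> hA hB; rewrite (gl_br_homogE hA hB); have sH := gl_homog_subspace (p (+) q).
apply: (subspaceB sH); first exact: gl_mul_homog.
by apply: (subspaceZ _ sH); rewrite addbC; apply: gl_mul_homog.
Qed.

Lemma gl_br_linl a A B C : gl_br (a *: A + B) C = a *: gl_br A C + gl_br B C.
Proof.
rewrite /gl_br !gl_proj_lin opprD !(mulmxDl, mulmxDr, mulmxN) -!scalemxAl -!scalemxAr.
by apply/matrixP => i j; rewrite !mxE; ring.
Qed.

Lemma gl_br_linr a A B C : gl_br C (a *: A + B) = a *: gl_br C A + gl_br C B.
Proof.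
rewrite /gl_br !gl_proj_lin !mulmxDl !mulmxDr -!scalemxAl -!scalemxAr.
by apply/matrixP => i j; rewrite !mxE; ring.
Qed.

Lemma gl_jacobi_homog p q r A B C : gl_homog p A -> gl_homog q B -> gl_homog r C ->
  gl_br A (gl_br B C) = gl_br (gl_br A B) C + (-1) ^+ (p && q) *: gl_br B (gl_br A C).
Proof.
move=> hA hB hC; rewrite (gl_br_homogE hA (gl_br_homog hB hC)).
rewrite (gl_br_homogE (gl_br_homog hA hB) hC) (gl_br_homogE hB (gl_br_homog hA hC)).
rewrite (gl_br_homogE hA hB) (gl_br_homogE hB hC) (gl_br_homogE hA hC).
rewrite !(mulmxBl, mulmxBr) -!scalemxAl -!scalemxAr !mulmxA.
move: (A *m B *m C) (A *m C *m B) (B *m A *m C) (B *m C *m A) (C *m A *m B) (C *m B *m A).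
move=> w1 w2 w3 w4 w5 w6; apply/matrixP => i j; rewrite !mxE.
by case: p q r {hA hB hC} => [] [] []; rewrite /= ?expr0 ?expr1; ring.
Qed.

Definition lsa_gl : lieSuperalgebra K.
Proof.
apply: (@LieSuperalgebra K 'M[K]_n gl_homog gl_br).
- exact: gl_homog_subspace.
- move=> A; exists (gl_proj false A), (gl_proj true A).
  by split; [apply: gl_proj_homog | apply: gl_proj_homog | apply: gl_proj_sum].
- move=> A h0 h1; apply/matrixP => i j; rewrite mxE.
  case e : (par i (+) par j); [apply: h0 | apply: h1]; by rewrite e.
- exact: gl_br_linl.
- exact: gl_br_linr.
- exact: gl_br_homog.
- move=> p q A B hA hB; rewrite (gl_br_homogE hA hB) (gl_br_homogE hB hA) andbC.
  by rewrite scalerBr scalerA -signr_addb addbb scale1r opprB.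
- move=> p q A B C hA hB.
  have brD X Y Z : gl_br X (Y + Z) = gl_br X Y + gl_br X Z.
    exact: (linD (fun a U V => gl_br_linr a U V X)).
  rewrite (gl_proj_sum C).
  move: (gl_proj_homog (p := false) C) (gl_proj_homog (p := true) C).
  move: (gl_proj false C) (gl_proj true C) => C0 C1 h0 h1.
  rewrite (brD B C0 C1) (brD A C0 C1) (brD (gl_br A B) C0 C1).
  rewrite (brD A (gl_br B C0)) (brD B (gl_br A C0)).
  rewrite (gl_jacobi_homog hA hB h0) (gl_jacobi_homog hA hB h1).
  by rewrite [in RHS]scalerDr; exact: addrACA.
- move=> A hA; rewrite (gl_br_homogE hA (gl_br_homog hA hA)) (gl_br_homogE hA hA) /=.
  by rewrite expr0 expr1 !scaleN1r !opprK scale1r mulmxDl mulmxDr mulmxA subrr.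
Defined.

(** Matrices supported on or above the d-th superdiagonal; the matrix analogue of
    the elements of degree at least d. *)
Definition gl_ord (d : nat) : set lsa_gl :=
  [set A : 'M[K]_n | forall i j : 'I_n, (j < i + d)%N -> A i j = 0].

Lemma gl_ord_subspace d : is_subspace (gl_ord d).
Proof.
split=> [i j _|a A B hA hB i j lt_j]; first by rewrite mxE.
by rewrite !mxE hA // hB // mulr0 addr0.
Qed.

Lemma gl_ord_proj d p A : gl_ord d A -> gl_ord d (gl_proj p A).
Proof. by move=> hA i j lt_j; rewrite mxE hA // if_same. Qed.

Lemma gl_ord_graded d : graded (gl_ord d).
Proof.
move=> A B hA hB hAB; rewrite -[A](gl_proj_id false hA).
have -> : B = gl_proj true (A + B).
  by rewrite -[A]scale1r gl_proj_lin (gl_proj_id _ hA) (gl_proj_id _ hB) /= scaler0 add0r.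
have -> : gl_proj false A = gl_proj false (A + B).
  rewrite -[A in RHS]scale1r gl_proj_lin [gl_proj _ B](gl_proj_id _ hB) /=.
  by rewrite scale1r addr0.
by split; apply: gl_ord_proj.
Qed.

Lemma gl_ord_mul d e (A B : 'M[K]_n) : gl_ord d A -> gl_ord e B -> gl_ord (d + e) (A *m B).
Proof.
move=> hA hB i j lt_j; rewrite mxE big1 // => k _.
have [lt_k|le_k] := ltnP k (i + d); first by rewrite hA // mul0r.
by rewrite [B k j]hB ?mulr0 //; lia.
Qed.

Lemma gl_ord_br d e (A B : lsa_gl) : gl_ord d A -> gl_ord e B -> gl_ord (d + e) (A ∙ B).
Proof.
move=> hA hB; rewrite /lsa_br /= /gl_br.
have sO := gl_ord_subspace (d + e).
apply: (subspaceB sO); first exact: gl_ord_mul.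
rewrite addnC; apply: (subspaceD (gl_ord_subspace _)); apply: gl_ord_mul; try exact: gl_ord_proj.
  exact: hA.
by apply: (subspaceB (gl_ord_subspace d)); apply: gl_ord_proj.
Qed.

Lemma gl_ordS d (A : lsa_gl) : gl_ord d.+1 A -> gl_ord d A.
Proof. by move=> hA i j lt_j; apply: hA; rewrite addnS ltnS ltnW. Qed.

End GradedMatrices.

Arguments gl_ord {K n} par d _.

(** * Words as matrix coefficients *)

Section Words.
Variables (K : fieldType) (T : eqType) (p : T -> bool) (w : seq T).

(** The grading of the row index that makes each letter homogeneous of its own
    parity. *)
Definition word_par (i : 'I_((size w).+1)) : bool := odd (count p (take i w)).

(** The representation in which the corner entry of a product of letters reads
    off the coefficient of the word w. *)
Definition letter (x : T) : 'M[K]_((size w).+1) :=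
  \matrix_(i, j) ((j == i.+1 :> nat) && (nth x w i == x))%:R.

Definition word_prod (u : seq T) : 'M[K]_((size w).+1) :=
  foldr (fun x M => letter x *m M) 1%:M u.

Definition top (A : 'M[K]_((size w).+1)) : K := A ord0 ord_max.

Lemma letter_homog x : gl_homog word_par (p x) (letter x).
Proof.
move=> i j ne; rewrite mxE; case: eqP => //= ej; case: eqP => //= ei; case/negP: ne.
have lt_iw : (i < size w)%N by rewrite -ltnS -ej ltn_ord.
rewrite /word_par ej (take_nth x lt_iw) -cats1 count_cat /= ei addn0 oddD.
by case: (odd _) (p x) => [] [].
Qed.

Lemma letter_ord x : gl_ord word_par 1 (letter x).
Proof. by move=> i j lt_j; rewrite mxE; case: eqP => // e; lia. Qed.

Lemma word_prodE u i j : word_prod u i j =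
  ((j == i + size u :> nat)%N && (take (size u) (drop i w) == u))%:R.
Proof.
elim: u i j => [|x u IHu] i j.
  by rewrite mxE addn0 take0 andbT eq_sym.
rewrite /= mxE; have [lt_iw|le_wi] := ltnP i (size w); last first.
  rewrite big1 => [|k _]; last first.
    by rewrite mxE; case: eqP => [e|]; rewrite ?mul0r //; have := ltn_ord k; lia.
  by case: eqP => // e; have := ltn_ord j; lia.
have lt_iw' : (i.+1 < (size w).+1)%N by [].
rewrite (bigD1 (Ordinal lt_iw')) //= big1 => [|k ne_k]; last first.
  rewrite mxE; case: eqP => [e|]; rewrite ?mul0r //.
  by case/eqP: ne_k; apply: val_inj.
rewrite addr0 mxE eqxx /= IHu /= addSnnS (drop_nth x lt_iw) /= eqseq_cons -natrM mulnb.
by rewrite andbCA.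
Qed.

Lemma top_word_prod u : size u = size w -> top (word_prod u) = (u == w)%:R.
Proof. by move=> eu; rewrite /top word_prodE drop0 eu add0n eqxx take_size eq_sym. Qed.

Lemma topB A B : top (A - B) = top A - top B.
Proof. by rewrite /top !mxE. Qed.

Lemma topZ a A : top (a *: A) = a * top A.
Proof. by rewrite /top mxE. Qed.

Local Notation G := (lsa_gl K word_par).

Lemma top_br3 a b c : size w = 3 ->
  top ((letter a : G) ∙ (letter b : G) ∙ (letter c : G)) =
  ([:: a; b; c] == w)%:R - (-1) ^+ (p a && p b) * ([:: b; a; c] == w)%:R
  - (-1) ^+ ((p a (+) p b) && p c) *
    (([:: c; a; b] == w)%:R - (-1) ^+ (p a && p b) * ([:: c; b; a] == w)%:R).
Proof.
move=> w3; have [ha hb hc] := And3 (@letter_homog a) (@letter_homog b) (@letter_homog c).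
have -> : (letter a : G) ∙ (letter b : G) ∙ (letter c : G) =
          gl_br word_par (gl_br word_par (letter a) (letter b)) (letter c) by [].
rewrite (gl_br_homogE (gl_br_homog ha hb) hc) (gl_br_homogE ha hb).
rewrite mulmxBl mulmxBr -scalemxAl -scalemxAr !mulmxA !(topB, topZ).
have tw x y z : top (letter x *m letter y *m letter z) = ([:: x; y; z] == w)%:R.
  by rewrite -top_word_prod // /= mulmx1 mulmxA.
by rewrite !tw.
Qed.

Lemma top_br4 a b c d : size w = 4 -> (forall x, p x = false) ->
  top ((letter a : G) ∙ (letter b : G) ∙ (letter c : G) ∙ (letter d : G)) =
  ([:: a; b; c; d] == w)%:R - ([:: b; a; c; d] == w)%:R
  - (([:: c; a; b; d] == w)%:R - ([:: c; b; a; d] == w)%:R)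
  - ([:: d; a; b; c] == w)%:R + ([:: d; b; a; c] == w)%:R
  + (([:: d; c; a; b] == w)%:R - ([:: d; c; b; a] == w)%:R).
Proof.
move=> w4 p0; have h x : gl_homog word_par false (letter x) by rewrite -(p0 x); apply: letter_homog.
have -> : (letter a : G) ∙ (letter b : G) ∙ (letter c : G) ∙ (letter d : G) =
  gl_br word_par (gl_br word_par (gl_br word_par (letter a) (letter b)) (letter c)) (letter d)
  by [].
rewrite (gl_br_homogE (gl_br_homog (gl_br_homog (h a) (h b)) (h c)) (h d)).
rewrite (gl_br_homogE (gl_br_homog (h a) (h b)) (h c)) (gl_br_homogE (h a) (h b)) /=.
rewrite !expr0 !scale1r !(mulmxBl, mulmxBr) !mulmxA !topB.
have tw x y z u : top (letter x *m letter y *m letter z *m letter u) = ([:: x; y; z; u] == w)%:R.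
  by rewrite -top_word_prod // /= mulmx1 !mulmxA.
by rewrite !tw; ring.
Qed.

End Words.

Section HallWords.
Variables (K : fieldType) (t : nat) (p : 'I_t -> bool).

(** In [[a, b], a] the word a b a has coefficient 1 + (-1)^|a|, which is 0 for
    odd a; this is why b a a is used when c = a. *)
Definition hall_word (x : hall t) : seq 'I_t :=
  let: (a, b, c) := val x in if c == a then [:: b; a; a] else [:: a; b; c].

Lemma size_hall_word x : size (hall_word x) = 3.
Proof. by rewrite /hall_word; case: (val x) => [[a b] c]; case: ifP. Qed.

Definition hall_letters (w : seq 'I_t) (x : hall t) : lsa_gl K (word_par p (w := w)) :=
  (letter K w (val x).1.1 : lsa_gl K (word_par p (w := w))) ∙ letter K w (val x).1.2
  ∙ letter K w (val x).2.

Lemma hall_word_dual x y : x != y -> top (hall_letters (hall_word x) y) = 0.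
Proof.
rewrite /hall_letters top_br3 ?size_hall_word // /hall_word -val_eqE.
case: x => [[[a b] c] abc]; case: y => [[[a' b'] c'] abc'] /=.
rewrite /= in abc abc'; rewrite !xpair_eqE -!val_eqE /= => ne.
case: ifP => ca; rewrite !eqseq_cons !andbT -!val_eqE /=;
  do 4! (case: (boolP [&& _, _ & _]) => [|_]; first by lia);
  by rewrite !mulr0 !subr0 mulr0 subr0.
Qed.

Lemma hall_word_diag x : top (hall_letters (hall_word x) x) != 0.
Proof.
rewrite /hall_letters top_br3 ?size_hall_word // /hall_word.
case: x => [[[a b] c] abc] /=; rewrite /= in abc.
have ca_nat : (c == a) = (c == a :> nat) by rewrite val_eqE.
case: ifP; rewrite ca_nat => ca; rewrite !eqseq_cons !andbT -!val_eqE /=.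
  have -> : [&& a == b :> nat, b == a :> nat & c == a :> nat] = false by lia.
  have -> : [&& b == b :> nat, a == a :> nat & c == a :> nat] = true by lia.
  have -> : [&& c == b :> nat, a == a :> nat & b == a :> nat] = false by lia.
  have -> : [&& c == b :> nat, b == a :> nat & a == a :> nat] = false by lia.
  by rewrite !mulr0 !subr0 mulr0 subr0 mulr1 sub0r oppr_eq0 signr_eq0.
have -> : [&& a == a :> nat, b == b :> nat & c == c :> nat] = true by lia.
have -> : [&& b == a :> nat, a == b :> nat & c == c :> nat] = false by lia.
have -> : [&& c == a :> nat, a == b :> nat & b == c :> nat] = false by lia.
have -> : [&& c == a :> nat, b == b :> nat & a == c :> nat] = false by lia.
by rewrite !mulr0 !subr0 mulr0 subr0 oner_eq0.
Qed.

End HallWords.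

(** * Lifting to matrices along a presentation *)

Section Approximation.
Variables (K : fieldType) (n : nat) (par : 'I_n -> bool).

Lemma gl_ord_le d e : (e <= d)%N -> gl_ord (K := K) par d `<=` gl_ord par e.
Proof. by move=> le_ed A hA i j lt_j; apply: hA; lia. Qed.

(** Replacing factors by approximations: the error is split as
    (A - A') C + A' (C - C'). *)
Lemma gl_br_approx d k e m (A A' C C' : lsa_gl K par) : (m <= d.+1)%N -> (m <= k + e)%N ->
  gl_ord par d (A - A') -> gl_ord par k A' -> gl_ord par e (C - C') -> gl_ord par 1 C ->
  gl_ord par m (A ∙ C - A' ∙ C').
Proof.
move=> le_md le_mke hA hA' hC hC1.
have -> : A ∙ C - A' ∙ C' = (A - A') ∙ C + A' ∙ (C - C').
  by rewrite brDl brDr brNl brNr addrA subrK.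
apply: (subspaceD (@gl_ord_subspace K n par _)).
  by apply: (gl_ord_le (d := d + 1)); [lia | apply: gl_ord_br].
exact/(gl_ord_le le_mke)/gl_ord_br.
Qed.

End Approximation.

Section LiftToMatrices.
Variables (K : fieldType) (F M : lieSuperalgebra K) (f : F -> M).
Hypothesis hf : lsa_hom f.
Variables (X : Type) (px : X -> bool) (ix : X -> F).
Hypothesis freeF : is_free_on px ix.
Variables (n : nat) (par : 'I_n -> bool) (q : nat) (g : M -> lsa_gl K par).
Hypothesis q_gt0 : (0 < q)%N.
Hypothesis g_lin : forall a (x y : M), g (a *: x + y) = a *: g x + g y.
Hypothesis g_homog : forall i x, homog M i x -> homog (lsa_gl K par) i (g x).
Hypothesis g_ord : forall x, gl_ord par 1 (g x).
Hypothesis g_br : forall x y, gl_ord par q (g (x ∙ y) - g x ∙ g y).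

(** The linear map g is a homomorphism only up to order q.  Freeness gives a true
    homomorphism with the same values on generators; the elements on which it
    agrees with g up to order q form a subalgebra, hence are everything. *)
Lemma lift_to_gl : exists psi : F -> lsa_gl K par, [/\ lsa_hom psi,
  forall x, gl_ord par q (psi x - g (f x)) & forall x, gl_ord par 1 (psi x)].
Proof.
have sO := @gl_ord_subspace K n par.
have [|[psi [hpsi psi_ix]] _] := freeF.2 (lsa_gl K par) (fun x => g (f (ix x))).
  by move=> x; apply/g_homog/(hom_homog hf)/freeF.1.
have ord1 x : gl_ord par q (psi x - g (f x)) -> gl_ord par 1 (psi x).
  move=> hx; rewrite -(subrK (g (f x)) (psi x)); apply: (subspaceD (sO _)) => //.
  exact: gl_ord_le hx.
suff approx : forall x, gl_ord par q (psi x - g (f x)).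
  by exists psi; split=> // y; apply: ord1.
pose del x := psi x - g (f x).
have del_lin a x y : del (a *: x + y) = a *: del x + del y.
  rewrite /del (hom_lin hpsi) (hom_lin hf) g_lin opprD addrACA -scalerBr.
  by [].
have del_homog i y : homog F i y -> homog (lsa_gl K par) i (del y).
  move=> hy; apply: homogB; first exact: (hom_homog hpsi).
  exact/g_homog/(hom_homog hf).
apply: (free_generated (B := [set x | gl_ord par q (del x)]) freeF) => [|y].
  split.
  - exact: (preim_subspace del_lin).
  - move=> x0 x1 h0 h1 /=; rewrite (linD del_lin) => hd.
    exact: (gl_ord_graded (del_homog _ _ h0) (del_homog _ _ h1) hd).
  - move=> y z /= hy hz; rewrite /del (hom_br hpsi) (hom_br hf).
    rewrite -(subrK (g (f y) ∙ g (f z)) (psi y ∙ psi z)) -addrA.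
    apply: (subspaceD (sO _)).
      by apply: gl_br_approx hy (g_ord _) hz (ord1 _ hz).
    by rewrite -opprB; apply: (subspaceN (sO _)).
by rewrite /= /del psi_ix subrr; apply: subspace0.
Qed.

(** On the kernel of f the homomorphism has order at least q, and each bracket
    raises the order by one. *)
Lemma lift_double_br (psi : F -> lsa_gl K par) : lsa_hom psi ->
  (forall x, gl_ord par q (psi x - g (f x))) -> (forall x, gl_ord par 1 (psi x)) ->
  forall x, double_br (hker f) x -> gl_ord par q.+2 (psi x).
Proof.
move=> hpsi approx ord1.
have g0 : g 0 = 0 by apply: (lin0 g_lin).
have ordS d (A : set F) : (forall x, A x -> gl_ord par d (psi x)) ->
    forall x, br_set A setT x -> gl_ord par d.+1 (psi x).
  move=> hA x hx.
  suff : br_set A setT `<=` [set x | gl_ord par d.+1 (psi x)] by apply.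
  apply: br_set_min => [|y z Ay _].
    exact: (preim_subspace (hom_lin hpsi) (@gl_ord_subspace K n par _)).
  by rewrite /= (hom_br hpsi) -addn1; apply: gl_ord_br; [apply: hA | apply: ord1].
apply: (ordS q.+1 (br_set (hker f) setT)); apply: (ordS q (hker f)) => x fx0; have := approx x.
by rewrite (fx0 : f x = 0) g0 subr0.
Qed.

End LiftToMatrices.

Lemma top_ord (K : fieldType) (T : eqType) (p : T -> bool) (w : seq T) d
    (A : lsa_gl K (word_par p (w := w))) :
  (size w < d)%N -> gl_ord (word_par p (w := w)) d A -> top A = 0.
Proof. by move=> lt_wd hA; apply: hA. Qed.

Section WordFunctional.
Variables (K : fieldType) (F M : lieSuperalgebra K) (f : F -> M).
Hypothesis hf : lsa_hom f.
Variables (X : Type) (px : X -> bool) (ix : X -> F).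
Hypothesis freeF : is_free_on px ix.
Variables (T : eqType) (p : T -> bool) (w : seq T) (q : nat).
Local Notation G := (lsa_gl K (word_par p (w := w))).
Variable g : M -> G.
Hypothesis size_w : size w = q.+1.
Hypothesis q_gt0 : (0 < q)%N.
Hypothesis g_lin : forall a (x y : M), g (a *: x + y) = a *: g x + g y.
Hypothesis g_homog : forall i x, homog M i x -> homog G i (g x).
Hypothesis g_ord : forall x, gl_ord (word_par p (w := w)) 1 (g x).
Hypothesis g_br : forall x y, gl_ord (word_par p (w := w)) q (g (x ∙ y) - g x ∙ g y).

(** The functional is the corner entry of the lift.  In size q + 2 all elements of
    order q + 2 have corner entry 0: this kills [[R, F], F], and lets the lift be
    replaced by g in commutators of weight 3 and 4. *)
Lemma word_functional : exists phi : F -> K^o,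
  [/\ forall a x y, phi (a *: x + y) = a *: phi x + phi y,
      forall x, double_br (hker f) x -> phi x = 0,
      forall x y z, phi (x ∙ y ∙ z) = top (g (f x) ∙ g (f y) ∙ g (f z))
    & forall x y z u,
        phi (x ∙ y ∙ z ∙ u) = top (g (f x) ∙ g (f y) ∙ g (f z) ∙ g (f u))].
Proof.
have [psi [hpsi approx ord1]] := lift_to_gl hf freeF q_gt0 g_lin g_homog g_ord g_br.
have hR := lift_double_br g_lin hpsi approx ord1.
have lt_wq : (size w < q.+2)%N by rewrite size_w.
have ord2 x y : gl_ord (word_par p (w := w)) 2 (g (f x) ∙ g (f y)).
  exact: (gl_ord_br (g_ord _) (g_ord _)).
have approx2 x y : gl_ord (word_par p (w := w)) q.+1
    (psi x ∙ psi y - g (f x) ∙ g (f y)).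
  exact: (gl_br_approx (d := q) (k := 1) (e := q) (leqnn q.+1) (leqnn q.+1)
    (approx x) (g_ord _) (approx y) (ord1 y)).
have approx3 x y z : gl_ord (word_par p (w := w)) q.+2
    (psi x ∙ psi y ∙ psi z - g (f x) ∙ g (f y) ∙ g (f z)).
  exact: (gl_br_approx (d := q.+1) (k := 2) (e := q) (leqnn q.+2) (leqnn q.+2)
    (approx2 x y) (ord2 _ _) (approx z) (ord1 z)).
have topE (A B : G) : gl_ord (word_par p (w := w)) q.+2 (A - B) -> top A = top B.
  by move=> /(top_ord lt_wq)/eqP; rewrite topB subr_eq0 => /eqP.
exists (fun x => top (psi x)); split.
- by move=> a x y; rewrite (hom_lin hpsi) /top !mxE.
- by move=> x /hR/(top_ord lt_wq).
- by move=> x y z; rewrite !(hom_br hpsi); apply: topE.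
- move=> x y z u; rewrite !(hom_br hpsi); apply: topE.
  have ord3 : gl_ord (word_par p (w := w)) 3 (g (f x) ∙ g (f y) ∙ g (f z)).
    exact: (gl_ord_br (ord2 x y) (g_ord (f z))).
  exact: (gl_br_approx (d := q.+2) (k := 3) (e := q) (leqnSn q.+2) (leqnSn q.+2)
    (approx3 x y z) ord3 (approx u) (ord1 u)).
Qed.

End WordFunctional.

(** * Matrix models of H(1,0) ⊕ A(a | b) *)

Section HeisenbergPlusAbelian.
Variables (K : fieldType) (a b : nat).
Local Notation M := (lsa_dsum (lsa_heis K) (lsa_abelian K a b)).
Local Notation t := (2 + (a + b))%N.

(** Coordinates of the class of x in M / M². *)
Definition ab_coord (x : M) : 'rV[K]_t :=
  row_mx (lsubmx (x.1 : 'rV[K]_(2 + 1))) (row_mx x.2.1 x.2.2).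

Definition ab_lift (r : 'rV[K]_t) : M :=
  ((row_mx (lsubmx r) 0 : 'rV[K]_(2 + 1)), (lsubmx (rsubmx r), rsubmx (rsubmx r))).

Lemma ab_liftK : cancel ab_lift ab_coord.
Proof. by move=> r; rewrite /ab_coord /= row_mxKl !hsubmxK. Qed.

Lemma ab_coord_lin c (x y : M) : ab_coord (c *: x + y) = c *: ab_coord x + ab_coord y.
Proof.
rewrite /ab_coord scale_row_mx add_row_mx scale_row_mx add_row_mx; congr row_mx.
by apply/rowP => i; rewrite !mxE.
Qed.

Lemma ab_coord_br (x y : M) : ab_coord (x ∙ y) = 0.
Proof.
rewrite /ab_coord /= /ab_br row_mx0 (_ : lsubmx _ = 0) ?row_mx0 //.
apply/rowP => i; rewrite mxE [RHS]mxE.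
by case: i => -[|[|i]] //= lti; rewrite !mxE mulr0.
Qed.

Definition ab_par (j : 'I_t) : bool := (2 + a <= j)%N.

Lemma ab_coord_homog i (x : M) j : homog M i x -> ab_par j != i -> ab_coord x 0 j = 0.
Proof.
move=> [h1 h2]; rewrite /ab_par /ab_coord; case: (split_ordP j) => {}j ->.
  rewrite row_mxEl /=; case: i h1 h2 => /= h1 h2; last by have := ltn_ord j; case: leqP => //; lia.
  by move=> _; rewrite mxE h1 mxE.
rewrite row_mxEr /=; case: (split_ordP j) => {}j ->.
  rewrite row_mxEl; case: i h1 h2 => /= h1 h2; first by rewrite h2 mxE.
  by have := ltn_ord j; case: leqP => //; lia.
rewrite row_mxEr; case: i h1 h2 => /= h1 h2; last by rewrite h2 mxE.
by case: leqP => //; lia.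
Qed.

Lemma heis_ab_br3 (x y z : M) : x ∙ y ∙ z = 0.
Proof. by congr pair; rewrite /= heis_br0l. Qed.

(** The map M / M² -> matrices sending the j-th basis vector to the letter j; a
    homomorphism up to order 2, which is enough for words of length 3. *)
Definition letters_of (w : seq 'I_t) (x : M) : lsa_gl K (word_par ab_par (w := w)) :=
  \sum_j ab_coord x 0 j *: letter K w j.

Lemma letters_of_lin w c (x y : M) :
  letters_of w (c *: x + y) = c *: letters_of w x + letters_of w y.
Proof.
rewrite /letters_of scaler_sumr -big_split /=; apply: eq_bigr => j _.
by rewrite ab_coord_lin !mxE scalerDl scalerA.
Qed.

Lemma letters_of_homog w i (x : M) :
  homog M i x -> homog (lsa_gl K (word_par ab_par (w := w))) i (letters_of w x).
Proof.
move=> hx; have sH := lsa_homog_subspace (lsa_gl K (word_par ab_par (w := w))) i.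
apply: (subspace_sum _ sH) => j; have [e|ne] := eqVneq (ab_par j) i.
  by apply: (subspaceZ _ sH); rewrite -e; apply: letter_homog.
by rewrite (ab_coord_homog hx ne) scale0r; apply: subspace0.
Qed.

Lemma letters_of_ord w (x : M) : gl_ord (word_par ab_par (w := w)) 1 (letters_of w x).
Proof.
apply: (subspace_sum _ (@gl_ord_subspace _ _ _ _)) => j.
by apply: (subspaceZ _ (@gl_ord_subspace _ _ _ _)); apply: letter_ord.
Qed.

Lemma letters_of_br w (x y : M) : gl_ord (word_par ab_par (w := w)) 2
  (letters_of w (x ∙ y) - letters_of w x ∙ letters_of w y).
Proof.
have sO := @gl_ord_subspace K _ (word_par ab_par (w := w)) 2.
apply: (subspaceB sO).
  apply: (subspace_sum _ sO) => j.
  by rewrite ab_coord_br mxE scale0r; apply: subspace0.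
by apply: (gl_ord_br (d := 1) (e := 1)); apply: letters_of_ord.
Qed.

Lemma letters_of_lift w j : letters_of w (ab_lift (delta_mx 0 j)) = letter K w j.
Proof.
rewrite /letters_of ab_liftK (bigD1 j) //= mxE !eqxx scale1r big1 ?addr0 // => i ne_ij.
by rewrite mxE (negPf ne_ij) andbF scale0r.
Qed.

Definition heis_coord (i : 'I_3) (x : M) : K := (x.1 : 'rV[K]_3) 0 i.

Local Notation o0 := (@Ordinal 3 0 isT).
Local Notation o1 := (@Ordinal 3 1 isT).
Local Notation o2 := (@Ordinal 3 2 isT).

Lemma heis_coord_lin i c (x y : M) :
  heis_coord i (c *: x + y) = c * heis_coord i x + heis_coord i y.
Proof. by rewrite /heis_coord !mxE. Qed.

Lemma heis_coord_br i (x y : M) : heis_coord i (x ∙ y) =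
  (heis_coord o0 x * heis_coord o1 y - heis_coord o1 x * heis_coord o0 y)
  * (i == o2)%:R.
Proof. by rewrite /heis_coord /= /heis_br !mxE eqxx. Qed.

Section HeisenbergWords.
Variable w : seq bool.
Local Notation G := (lsa_gl K (word_par xpred0 (w := w))).
Let A : G := letter K w false.
Let B : G := letter K w true.

(** x1 |-> A, x2 |-> B, z |-> [A, B] for two even letters; a homomorphism up to
    order 3, which is enough for words of length 4. *)
Definition heis_letters (x : M) : G :=
  heis_coord o0 x *: A + heis_coord o1 x *: B + heis_coord o2 x *: (A ∙ B).

Lemma heis_letters_lin c (x y : M) :
  heis_letters (c *: x + y) = c *: heis_letters x + heis_letters y.
Proof.
rewrite /heis_letters !heis_coord_lin !scalerDl -!scalerA !scalerDr.
by rewrite [RHS]addrACA; congr (_ + _); rewrite [RHS]addrACA.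
Qed.

Lemma heis_letters_homog i (x : M) : homog M i x -> homog G i (heis_letters x).
Proof.
have sH := lsa_homog_subspace G.
have hA : homog G false A by apply: letter_homog.
have hB : homog G false B by apply: letter_homog.
case: i => -[hx _].
  have h0 j : heis_coord j x = 0 by rewrite /heis_coord hx mxE.
  by rewrite /heis_letters !h0 !scale0r !addr0; apply: subspace0.
apply: (subspaceD (sH false)); last by apply: (subspaceZ _ (sH _)); apply: (lsa_br_homog hA hB).
by apply: (subspaceD (sH false)); apply: (subspaceZ _ (sH _)).
Qed.

Let sO := @gl_ord_subspace K _ (word_par xpred0 (w := w)).
Let oA : gl_ord (word_par xpred0 (w := w)) 1 A. Proof. exact: letter_ord. Qed.
Let oB : gl_ord (word_par xpred0 (w := w)) 1 B. Proof. exact: letter_ord. Qed.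
Let oAB : gl_ord (word_par xpred0 (w := w)) 2 (A ∙ B).
Proof. exact: (gl_ord_br oA oB). Qed.

Lemma heis_letters_ord (x : M) : gl_ord (word_par xpred0 (w := w)) 1 (heis_letters x).
Proof.
apply: (subspaceD (sO 1)); last by apply: (subspaceZ _ (sO 1)); apply: gl_ordS.
by apply: (subspaceD (sO 1)); apply: (subspaceZ _ (sO 1)).
Qed.

Hypothesis char2 : (2%:R : K) != 0.

Lemma heis_letters_br (x y : M) : gl_ord (word_par xpred0 (w := w)) 3
  (heis_letters (x ∙ y) - heis_letters x ∙ heis_letters y).
Proof.
have hA : homog G false A by apply: letter_homog.
have hB : homog G false B by apply: letter_homog.
have [z0 z1] : (o0 == o2) = false /\ (o1 == o2) = false by [].
rewrite /heis_letters !heis_coord_br z0 z1 eqxx !mulr0 !scale0r !add0r mulr1.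
move: (heis_coord o0 x) (heis_coord o1 x) (heis_coord o2 x) => x0 x1 x2.
move: (heis_coord o0 y) (heis_coord o1 y) (heis_coord o2 y) => y0 y1 y2.
pose C := A ∙ B; pose U := x0 *: A + x1 *: B; pose V := y0 *: A + y1 *: B.
have UV : U ∙ V = (x0 * y1 - x1 * y0) *: C.
  rewrite brDl !brDr !brZl !brZr (br_even_sq char2 hA) (br_even_sq char2 hB).
  rewrite (lsa_skew hB hA) expr0 scale1r !scaler0 add0r addr0 !scalerN !scalerA.
  by rewrite scalerBl.
have oV : gl_ord (word_par xpred0 (w := w)) 1 V.
  by apply: (subspaceD (sO 1)); apply: (subspaceZ _ (sO 1)).
have oU : gl_ord (word_par xpred0 (w := w)) 1 U.
  by apply: (subspaceD (sO 1)); apply: (subspaceZ _ (sO 1)).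
have oC c : gl_ord (word_par xpred0 (w := w)) 2 (c *: C) by apply: (subspaceZ _ (sO 2)).
rewrite -/C -/U -/V; clearbody U V C; rewrite -UV brDl (brDr V).
have cancel (u v v' : G) : u - (u + v + v') = - (v + v') by rewrite -addrA opprD addrA subrr add0r.
rewrite cancel.
apply: (subspaceN (sO 3)); apply: (subspaceD (sO 3)).
  exact: (gl_ord_br (d := 1) (e := 2)).
apply: (gl_ord_br (d := 2) (e := 1)) => //.
by apply: (subspaceD (sO 1)) => //; apply: gl_ordS.
Qed.

End HeisenbergWords.
End HeisenbergPlusAbelian.

(** * The lower bound for H(1,0) ⊕ A(a | b) *)

(** Words detecting [[z, a], a], [[z, a], b], [[z, b], b] for z = [a, b], with
    a = false and b = true.  They have different contents, so that the dual
    relations hold off the diagonal for reasons of multidegree. *)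
Definition quad_word (i : 'I_3) : seq bool :=
  nth [::] [:: [:: true; false; false; false]; [:: false; false; true; true];
               [:: false; true; true; true]] i.

(** The last two entries (a, a), (a, b), (b, b). *)
Definition quad_tail (i : 'I_3) : bool * bool := (i == 2 :> nat, i != 0 :> nat).

Lemma size_quad_word i : size (quad_word i) = 4.
Proof. by case: i => -[|[|[|]]]. Qed.

Section QuadDual.
Variable K : fieldType.

Definition quad_letters (w : seq bool) (i : 'I_3) : lsa_gl K (word_par xpred0 (w := w)) :=
  (letter K w false : lsa_gl K (word_par xpred0 (w := w))) ∙ letter K w true
  ∙ letter K w (quad_tail i).1 ∙ letter K w (quad_tail i).2.

Lemma quad_word_dual i j : i != j -> top (quad_letters (quad_word i) j) = 0.
Proof.
rewrite /quad_letters top_br4 ?size_quad_word // -val_eqE.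
by case: i => -[|[|[|]]] //= ? ; case: j => -[|[|[|]]] //= ? _; ring.
Qed.

Lemma quad_word_diag i : top (quad_letters (quad_word i) i) != 0.
Proof.
rewrite /quad_letters top_br4 ?size_quad_word //.
by case: i => -[|[|[|]]] //= ?; rewrite !(subr0, sub0r, addr0, oppr0, add0r) ?oppr_eq0 oner_eq0.
Qed.

End QuadDual.

Section LowerBound.
Variables (K : fieldType) (a b : nat).
Hypothesis char2 : (2%:R : K) != 0.
Local Notation M := (lsa_dsum (lsa_heis K) (lsa_abelian K a b)).
Local Notation t := (2 + (a + b))%N.
Variables (F : lieSuperalgebra K) (f : F -> M).
Hypothesis hf : lsa_hom f.
Hypothesis f_surj : forall y, exists x, f x = y.
Variables (X : Type) (px : X -> bool) (ix : X -> F).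
Hypothesis freeF : is_free_on px ix.

(** In a linear relation between the chosen elements modulo [[R, F], F], words of
    length 3 do not see commutators of weight 4 and isolate each Hall commutator;
    then words of length 4 isolate the three remaining elements. *)
Lemma mult2_lower d : quot_dim (hker f `&` double_br setT) (double_br (hker f)) d ->
  (#|{: hall t}| + 3 <= d)%N.
Proof.
have /choice[v fv] : forall j : 'I_t, exists x, f x = ab_lift (delta_mx 0 j).
  by move=> j; apply: f_surj.
have /choice[u fu] : forall x : bool, exists y, f y =
    ((delta_mx 0 (if x then @Ordinal 3 1 isT else @Ordinal 3 0 isT) : 'rV[K]_3), 0).
  by move=> x; apply: f_surj.
have letter_u w x : heis_letters w (f (u x)) = letter K w x.
  rewrite fu /heis_letters /heis_coord; case: x; rewrite /= !mxE eqxx /=;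
    by rewrite !scale0r scale1r ?add0r !addr0.
pose e (i : hall t + 'I_3) : F := match i with
  | inl x => hall_br v x
  | inr i => u false ∙ u true ∙ u (quad_tail i).1 ∙ u (quad_tail i).2
  end.
move=> Hd; have -> : (#|{: hall t}| + 3 = #|{: hall t + 'I_3}|)%N.
  by rewrite card_sum card_ord.
apply: (indepm_le_quot_dim (f := e) _ _ _ Hd).
- exact: double_br_subspace.
- case=> [x|i]; split; rewrite /hker /= ?(hom_br hf) ?heis_ab_br3 ?br0l //;
    by [apply: mem_double_br | rewrite -[_ ∙ u _ ∙ _]/(_); apply: mem_double_br].
move=> c; rewrite big_sumType /= => Rc.
have c0 x : c (inl x) = 0.
  pose w := hall_word x.
  have [phi [lin kill phi3 phi4]] := word_functional hf freeF (size_hall_word x)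
    isT (@letters_of_lin K a b w) (@letters_of_homog K a b w) (@letters_of_ord K a b w)
    (@letters_of_br K a b w).
  have := kill _ Rc; rewrite (linD lin) !(lin_sum lin).
  rewrite [X in _ + X]big1 => [|i _]; last first.
    rewrite (linZ lin) phi4 (_ : top _ = 0) ?scaler0 //.
    apply: (top_ord (d := 4)); first by rewrite size_hall_word.
    have o1 y := @letters_of_ord K a b w (f y).
    exact: (gl_ord_br (gl_ord_br (gl_ord_br (o1 _) (o1 _)) (o1 _)) (o1 _)).
  rewrite addr0 (bigD1 x) //= big1 => [|y ne_yx]; last first.
    rewrite (linZ lin) /hall_br phi3 !fv !letters_of_lift.
    by rewrite hall_word_dual ?scaler0 // eq_sym.
  rewrite addr0 (linZ lin) /hall_br phi3 !fv !letters_of_lift => /eqP.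
  by rewrite mulf_eq0 (negPf (hall_word_diag K (@ab_par a b) x)) orbF => /eqP.
have {}Rc : double_br (hker f) (\sum_i c (inr i) *: e (inr i)).
  by move: Rc; rewrite big1 ?add0r // => x _; rewrite c0 scale0r.
have d0 i : c (inr i) = 0.
  pose w := quad_word i.
  have [phi [lin kill _ phi4]] := word_functional hf freeF (size_quad_word i)
    isT (@heis_letters_lin K a b w) (@heis_letters_homog K a b w) (@heis_letters_ord K a b w)
    (@heis_letters_br K a b w char2).
  have := kill _ Rc; rewrite (lin_sum lin) (bigD1 i) //= big1 => [|j ne_ji]; last first.
    by rewrite (linZ lin) phi4 !letter_u quad_word_dual ?scaler0 // eq_sym.
  rewrite addr0 (linZ lin) phi4 !letter_u => /eqP.
  by rewrite mulf_eq0 (negPf (quad_word_diag K i)) orbF => /eqP.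
by case=> [x|i]; [apply: c0 | apply: d0].
Qed.

End LowerBound.

(** * Recognition of H(1,0) ⊕ A *)

Lemma lsa_iso_inverse (K : fieldType) (G H : lieSuperalgebra K) (g : H -> G) :
  lsa_hom g -> (forall x, g x = 0 -> x = 0) -> (forall y, exists x, g x = y) ->
  lsa_iso G H.
Proof.
move=> hg g0 g_surj; have g_lin := hom_lin hg.
have g_inj : injective g.
  by move=> x y e; apply/subr0_eq/g0; rewrite (linB g_lin) e subrr.
have /choice[f gf] := g_surj.
have fg : cancel g f by move=> x; apply: g_inj; rewrite gf.
exists f; split; last by exists g.
split=> [c x y|i x hx|x y].
- by apply: g_inj; rewrite gf g_lin !gf.
- have [z hz gz] := homog_lift hg g_surj hx.
  by rewrite -gz fg.
- by apply: g_inj; rewrite gf (hom_br hg) !gf.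
Qed.

Section HeisenbergStructure.
Variables (K : fieldType) (L : lieSuperalgebra K) (k l : nat).
Hypothesis char2 : (2%:R : K) != 0.
Hypothesis dimL : @has_sdim K L setT k l.
Variables a b : L.
Local Notation z := (a ∙ b).
Hypotheses (ha : homog L false a) (hb : homog L false b) (z_neq0 : z != 0).
Hypothesis derived_z : forall x y : L, exists c, x ∙ y = c *: z.
Hypothesis z_central : forall y, z ∙ y = 0.
Hypothesis perp_ab : forall c d, homogeneous c -> homogeneous d ->
  a ∙ c = 0 -> b ∙ c = 0 -> a ∙ d = 0 -> b ∙ d = 0 -> c ∙ d = 0.

Let hz : homog L false z. Proof. exact: (lsa_br_homog ha hb). Qed.
Let s0 := @subspace_zero K L.
Let sH := lsa_homog_subspace L.

Let scale_z c : c *: z = 0 -> c = 0.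
Proof. by move=> /eqP; rewrite scaler_eq0 (negPf z_neq0) orbF => /eqP. Qed.

Let brC0 (x y : L) : homogeneous x -> homogeneous y -> x ∙ y = 0 -> y ∙ x = 0.
Proof. exact: (brC_mem s0). Qed.

Let ba : b ∙ a = - z.
Proof. by rewrite (lsa_skew hb ha) scale1r. Qed.

Let az : a ∙ z = 0.
Proof. by apply: brC0 (z_central a); [exists false | exists false]. Qed.

Let bz : b ∙ z = 0.
Proof. by apply: brC0 (z_central b); [exists false | exists false]. Qed.

(** The orthogonal of the plane <a, b>. *)
Let C : set L := [set c | a ∙ c = 0 /\ b ∙ c = 0].

Let sC : is_subspace C.
Proof. exact: (subspaceI (br_preimr a s0) (br_preimr b s0)). Qed.

Let gC : graded C.
Proof.
have g0 := ideal_graded (@ideal0 K L).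
have gx x : homog L false x -> graded [set c | x ∙ c = 0].
  move=> hx x0 x1 h0 h1 /=; rewrite brDr => e.
  exact: g0 (lsa_br_homog hx h0) (lsa_br_homog hx h1) e.
move=> x0 x1 h0 h1 [e1 e2].
have [? ?] := gx _ ha _ _ h0 h1 e1; have [? ?] := gx _ hb _ _ h0 h1 e2.
by split.
Qed.

Let CC c d : C c -> C d -> c ∙ d = 0.
Proof.
move=> Cc Cd.
suff : br_set C C `<=` [set 0] by apply; apply: mem_br_set.
apply: (br_set_min_homog gC gC s0) => x y hx hy [ax bx] [ay by_].
exact: perp_ab.
Qed.

Let Ca c : C c -> c ∙ a = 0.
Proof.
suff : C `<=` [set c | c ∙ a = 0] by apply.
apply: (graded_sub gC (br_preiml a s0)) => x hx [ax _].
by apply: brC0 ax => //; exists false.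
Qed.

Let Cb c : C c -> c ∙ b = 0.
Proof.
suff : C `<=` [set c | c ∙ b = 0] by apply.
apply: (graded_sub gC (br_preiml b s0)) => x hx [_ bx].
by apply: brC0 bx => //; exists false.
Qed.

Let abz : set L := adjoin (adjoin (adjoin [set 0] a) b) z.

Let even_complement : exists k', k = (k' + 3)%N /\ quot_dim (homog L false) abz k'.
Proof.
have [Hk _] := dimL; rewrite setTI in Hk.
have sub0 : [set 0] `<=` homog L false by move=> _ ->; apply: subspace0.
have na : ~ [set 0] a by move=> a0; case/eqP: z_neq0; rewrite a0 br0l.
have s1 := spanm_subspace (fun _ : 'I_1 => a) s0.
have s2 := spanm_subspace (fun _ : 'I_1 => b) s1.
have sub1 : adjoin [set 0] a `<=` homog L false by apply: spanm_min.
have sub2 : adjoin (adjoin [set 0] a) b `<=` homog L false by apply: spanm_min.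
have nb : ~ adjoin [set 0] a b.
  move=> [c]; rewrite big_ord1 => /subr0_eq eb.
  by case/eqP: z_neq0; rewrite eb brZr br_even_sq // scaler0.
have nz : ~ adjoin (adjoin [set 0] a) b z.
  move=> [d [c]]; rewrite !big_ord1 => /subr0_eq e.
  have ez : z = c ord0 *: a + d ord0 *: b by rewrite -e subrK.
  have d0 : d ord0 = 0.
    have : a ∙ (c ord0 *: a + d ord0 *: b) = 0 by rewrite -ez.
    by rewrite brDr !brZr br_even_sq // scaler0 add0r => /scale_z.
  have c0 : c ord0 = 0.
    have : b ∙ (c ord0 *: a + d ord0 *: b) = 0 by rewrite -ez.
    rewrite d0 scale0r addr0 brZr ba scalerN -scaleNr => /scale_z/eqP.
    by rewrite oppr_eq0 => /eqP.
  by case/eqP: z_neq0; rewrite ez c0 d0 !scale0r addr0.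
have [k1 Hk1 ek] := quot_dim_exchange s0 (sH false) sub0 ha na Hk.
have [k2 Hk2 ek1] := quot_dim_exchange s1 (sH false) sub1 hb nb Hk1.
have [k3 Hk3 ek2] := quot_dim_exchange s2 (sH false) sub2 hz nz Hk2.
by exists k3; split=> //; rewrite ek ek1 ek2 addn3.
Qed.

(** A complement of <a, b, z> in the even part can be moved by multiples of a and b
    into the orthogonal of <a, b>, which contains the odd part and z and is central. *)
Lemma heis_structure :
  lsa_iso L (lsa_dsum (lsa_heis K) (lsa_abelian K (k - 3) l)).
Proof.
have [k' [-> [e [He se ie]]]] := even_complement; rewrite addnK.
have [_ [o [Ho so io]]] := dimL.
have /choice[al Eal] : forall i, exists c, a ∙ e i = c *: z by move=> i; apply: derived_z.
have /choice[be Ebe] : forall i, exists c, b ∙ e i = c *: z by move=> i; apply: derived_z.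
pose e' i := e i - al i *: b + be i *: a.
have he' i : homog L false (e' i).
  apply: (subspaceD (sH false)); last by apply: (subspaceZ _ (sH false)).
  by apply: (subspaceB (sH false)) => //; apply: (subspaceZ _ (sH false)).
have Ce' i : C (e' i).
  split; rewrite /e' !brDr brNr !brZr ?Eal ?Ebe ?ba !(br_even_sq char2) //.
    by rewrite scaler0 addr0 subrr.
  by rewrite scaler0 subr0 scalerN subrr.
have Co j : C (o j).
  have [_ hoj] := Ho j.
  have odd0 x : homog L false x -> x ∙ o j = 0.
    move=> hx; have [c Ec] := derived_z x (o j).
    apply: lsa_homog_cap (lsa_br_homog hx hoj).
    by rewrite Ec; apply: (subspaceZ _ (sH false)).
  by split; apply: odd0.
have Cz : C z by [].
have s1 : is_subspace (adjoin (adjoin [set 0] a) b) by do 2 apply: spanm_subspace.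
have sabz : is_subspace abz by apply: spanm_subspace.
have za : abz a.
  by apply/(sub_spanm _ s1)/(sub_spanm _ (spanm_subspace _ s0)); apply: (mem_spanm _ ord0 s0).
have zb : abz b.
  by apply: (sub_spanm _ s1); apply: (mem_spanm _ ord0 (spanm_subspace _ s0)).
have zz : abz z by apply: (mem_spanm _ ord0 s1).
have ee' i : e i - e' i = al i *: b - be i *: a.
  by rewrite /e' opprD opprB addrA [e i + _]addrC subrK.
have zee' i : abz (e i - e' i).
  by rewrite ee'; apply: (subspaceB sabz); apply: (subspaceZ _ sabz).
pose M := lsa_dsum (lsa_heis K) (lsa_abelian K k' l).
pose N (m : M) : L := (m.1 : 'rV[K]_3) 0 (@Ordinal 3 2 isT) *: z
  + (\sum_i (m.2.1 : 'rV[K]_k') 0 i *: e' i + \sum_j (m.2.2 : 'rV[K]_l) 0 j *: o j).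
pose h0 (m : M) : K := (m.1 : 'rV[K]_3) 0 (@Ordinal 3 0 isT).
pose h1 (m : M) : K := (m.1 : 'rV[K]_3) 0 (@Ordinal 3 1 isT).
pose g (m : M) : L := (h0 m *: a + h1 m *: b) + N m.
have CN m : C (N m).
  apply: (subspaceD sC); first exact: (subspaceZ _ sC).
  by apply: (subspaceD sC); apply: (subspace_sum _ sC) => i; apply: (subspaceZ _ sC).
have N_lin c (x y : M) : N (c *: x + y) = c *: N x + N y.
  have sumD n (u v : 'rV[K]_n) (w : 'I_n -> L) : \sum_i (c *: u + v) 0 i *: w i =
      c *: (\sum_i u 0 i *: w i) + \sum_i v 0 i *: w i.
    rewrite scaler_sumr -big_split /=; apply: eq_bigr => i _.
    by rewrite !mxE scalerDl scalerA.
  rewrite /N /= !sumD !mxE scalerDl !scalerDr scalerA [RHS]addrACA; congr (_ + _).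
  by rewrite [RHS]addrACA.
have g_lin c (x y : M) : g (c *: x + y) = c *: g x + g y.
  rewrite /g N_lin /h0 /h1 !mxE !scalerDl !scalerDr !scalerA [RHS]addrACA; congr (_ + _).
  by rewrite [RHS]addrACA.
have g_br (x y : M) : g (x ∙ y) = g x ∙ g y.
  have [CNx CNy] := (CN x, CN y).
  have [aNy bNy] := CNy.
  have -> : g (x ∙ y) = (h0 x * h1 y - h1 x * h0 y) *: z.
    rewrite /g /h0 /h1 /N /= /heis_br !mxE /= !mulr0 !scale0r !add0r mulr1.
    rewrite !big1 ?addr0 // => [j _|i _]; by rewrite mxE scale0r.
  have gE : forall u v u' v' : L, u' ∙ v = 0 -> u ∙ v' = 0 -> u' ∙ v' = 0 ->
      (u + u') ∙ (v + v') = u ∙ v.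
    by move=> u v u' v' e1 e2 e3; rewrite brDl !brDr e1 e2 e3 !addr0.
  rewrite /g gE.
  - rewrite brDl !brDr !brZl !brZr !(br_even_sq char2) // ba !scaler0 add0r addr0.
    by rewrite !scalerN !scalerA scalerBl.
  - by rewrite brDr !brZr (Ca CNx) (Cb CNx) !scaler0 addr0.
  - by rewrite brDl !brZl aNy bNy !scaler0 addr0.
  - exact: CC.
have g_homog i (x : M) : homog M i x -> homog L i (g x).
  move=> [hx1 hx2]; case: i hx1 hx2 => /= hx1 hx2.
    rewrite /g /h0 /h1 /N hx1 hx2 !mxE !scale0r !add0r big1 => [|i _]; last by rewrite mxE scale0r.
    rewrite add0r; apply: (subspace_sum _ (sH true)) => j; apply: (subspaceZ _ (sH true)).
    by case: (Ho j).
  rewrite /g /N hx2 [X in _ + (_ + (_ + X))]big1 => [|j _]; last by rewrite mxE scale0r.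
  rewrite addr0; apply: (subspaceD (sH false)).
    by apply: (subspaceD (sH false)); apply: (subspaceZ _ (sH false)).
  apply: (subspaceD (sH false)); first by apply: (subspaceZ _ (sH false)).
  by apply: (subspace_sum _ (sH false)) => i; apply: (subspaceZ _ (sH false)).
have hg : lsa_hom g by split.
apply: (lsa_iso_inverse hg) => [m gm0|y].
  have [aN bN] := CN m.
  have m1 : h1 m = 0.
    have : a ∙ g m = 0 by rewrite gm0 br0r.
    by rewrite /g (brDr _ (N m)) aN addr0 brDr !brZr (br_even_sq char2) //
      scaler0 add0r => /scale_z.
  have m0 : h0 m = 0.
    have : b ∙ g m = 0 by rewrite gm0 br0r.
    rewrite /g (brDr _ (N m)) bN addr0 brDr !brZr (br_even_sq char2) //
      scaler0 addr0 ba scalerN -scaleNr.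
    by move=> /scale_z/eqP; rewrite oppr_eq0 => /eqP.
  move: gm0; rewrite /g m0 m1 !scale0r !add0r /N addrA.
  set ev := (X in X + _ = _); set od := (X in _ + X = _) => eo.
  have hev : homog L false ev.
    apply: (subspaceD (sH false)); first by apply: (subspaceZ _ (sH false)).
    by apply: (subspace_sum _ (sH false)) => i; apply: (subspaceZ _ (sH false)).
  have hod : homog L true od.
    apply: (subspace_sum _ (sH true)) => j; apply: (subspaceZ _ (sH true)).
    by case: (Ho j).
  have eo' : ev + od = 0 + 0 by rewrite addr0.
  have [ev0 od0] := homog_sum_inj hev hod (subspace0 (sH false)) (subspace0 (sH true)) eo'.
  have m22 : m.2.2 = 0 by apply/rowP => j; rewrite mxE; apply: (io _ od0).
  have m21 : m.2.1 = 0.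
    apply/rowP => i; rewrite mxE; apply: (ie (fun i => m.2.1 0 i)).
    rewrite (eq_bigr (fun i => m.2.1 0 i *: (e i - e' i) + m.2.1 0 i *: e' i)).
      rewrite big_split /=; apply: (subspaceD sabz).
        by apply: (subspace_sum _ sabz) => j; apply: (subspaceZ _ sabz).
      move: ev0; rewrite /ev addrC => /eqP; rewrite addr_eq0 => /eqP ->.
      by apply: (subspaceN sabz); apply: (subspaceZ _ sabz).
    by move=> j _; rewrite -scalerDr subrK.
  move: ev0; rewrite /ev m21 big1 => [|i _]; last by rewrite mxE scale0r.
  rewrite addr0 => /scale_z m2.
  case: m m0 m1 m2 m21 m22 {aN bN ev od eo hev hod eo' od0} => h [u v].
  rewrite /h0 /h1 /= => e0 e1 e2 -> ->; congr (_, _); apply/rowP => i.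
  rewrite mxE; case: i => -[|[|[|]]] //= lti; [rewrite -e0|rewrite -e1|rewrite -e2];
    by congr (h 0 _); apply: val_inj.
pose I : set L := [set y | exists m, g m = y].
have sI : is_subspace I.
  split; first by exists 0; apply: (lin0 g_lin).
  by move=> c _ _ [m <-] [m' <-]; exists (c *: m + m'); apply: g_lin.
have sum0 n (w : 'I_n -> L) : \sum_i (0 : 'rV[K]_n) 0 i *: w i = 0.
  by rewrite big1 // => i _; rewrite mxE scale0r.
have sum1 n (w : 'I_n -> L) j : \sum_i (delta_mx 0 j : 'rV[K]_n) 0 i *: w i = w j.
  rewrite (bigD1 j) //= mxE !eqxx scale1r big1 ?addr0 // => i /negPf ne.
  by rewrite mxE ne andbF scale0r.
pose heis_unit i : M := ((delta_mx 0 i : 'rV[K]_3), 0).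
have Ia : I a.
  exists (heis_unit (@Ordinal 3 0 isT)).
  by rewrite /g /N /h0 /h1 /= !sum0 !mxE /= !scale0r scale1r !addr0.
have Ib : I b.
  exists (heis_unit (@Ordinal 3 1 isT)).
  by rewrite /g /N /h0 /h1 /= !sum0 !mxE /= !scale0r scale1r !addr0 add0r.
have Iz : I z.
  exists (heis_unit (@Ordinal 3 2 isT)).
  by rewrite /g /N /h0 /h1 /= !sum0 !mxE /= !scale0r scale1r !addr0 add0r.
have Ie' i : I (e' i).
  exists (0, (delta_mx 0 i, 0)).
  by rewrite /g /N /h0 /h1 /= sum0 sum1 !mxE /= !scale0r !addr0 !add0r.
have Io j : I (o j).
  exists (0, (0, delta_mx 0 j)).
  by rewrite /g /N /h0 /h1 /= sum0 sum1 !mxE /= !scale0r !add0r.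
have Ie i : I (e i).
  rewrite -(subrK (e' i) (e i)); apply: (subspaceD sI) => //.
  by rewrite ee'; apply: (subspaceB sI); apply: (subspaceZ _ sI).
have [y0 [y1 [hy0 hy1 ->]]] := lsa_homog_sum y.
apply: (subspaceD sI).
  have := se _ hy0; apply: spanm_min => //.
  by do 3 (apply: spanm_min => //); move=> _ ->; apply: subspace0.
have [c /= /subr0_eq ->] := so y1 (conj Logic.I hy1).
by apply: (subspace_sum _ sI) => j; apply: (subspaceZ _ sI).
Qed.

End HeisenbergStructure.

(** * The inequalities and the case of equality *)

Lemma hall_natr t : (#|{: hall t}|%:R : rat) = (t%:R ^+ 3 - t%:R) / 3%:R.
Proof.
have /(congr1 (fun n : nat => n%:R : rat)) := card_hall t.
by rewrite natrD natrM natrX => <-; field.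
Qed.

Lemma cubic_bound_eq (k l r s t m : nat) : (t + (r + s) = k + l)%N -> (r + s = m.+1)%N ->
  1 / 3%:R * (k%:R + l%:R) * (k%:R + l%:R - 1) * (k%:R + l%:R - 2%:R) + 3%:R
  = (#|{: hall (t + m)}| + 3)%:R :> rat.
Proof.
move=> e1 e2; have -> : (k%:R + l%:R : rat) = (t + m)%:R + 1.
  by rewrite -natrD -e1 e2 addnS -natr1.
by rewrite [RHS]natrD hall_natr; field.
Qed.

Lemma refined_bound_eq (k l r s t m : nat) : (t + (r + s) = k + l)%N -> (r + s = m.+1)%N ->
  1 / 3%:R * (k%:R + l%:R - r%:R - s%:R) *
    ((k%:R + l%:R + 2%:R * r%:R + 2%:R * s%:R - 2%:R) *
       (k%:R + l%:R - r%:R - s%:R - 1) + 3%:R * (r%:R + s%:R - 1)) + 3%:R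
  = (#|{: hall t}| + m * t ^ 2 + 3)%:R :> rat.
Proof.
move=> e1 e2.
have er : (r%:R + s%:R : rat) = m%:R + 1 by rewrite -natrD e2 -natr1.
have ek : (k%:R + l%:R : rat) = t%:R + (m%:R + 1) by rewrite -natrD -e1 natrD e2 -natr1.
have -> : (r%:R : rat) = m%:R + 1 - s%:R by rewrite -er addrK.
by rewrite ek !natrD hall_natr natrM natrX; field.
Qed.

(** The difference of the two sides is t m² + (m³ - m)/3. *)
Lemma refined_le_cubic t m : (#|{: hall t}| + m * t ^ 2 <= #|{: hall (t + m)}|)%N.
Proof.
have := card_hall t; have := card_hall (t + m).
rewrite !expnS !expn0 !muln1 => e1 e2.
have : (m <= m * (m * m))%N by case: m {e1} => // m; rewrite leq_pmulr.
nia.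
Qed.

Lemma refined_lt_cubic t m : (0 < t)%N -> (0 < m)%N ->
  (#|{: hall t}| + m * t ^ 2 < #|{: hall (t + m)}|)%N.
Proof.
move=> t0 m0; have := card_hall t; have := card_hall (t + m).
rewrite !expnS !expn0 !muln1 => e1 e2.
have : (m <= m * (m * m))%N by case: m m0 {e1} => // m _; rewrite leq_pmulr.
have : (0 < t * (m * m))%N by rewrite !muln_gt0 t0 m0.
nia.
Qed.

Section Equality.
Variables (K : fieldType) (L : lieSuperalgebra K) (k l r s : nat).
Hypotheses (char2 : (2%:R : K) != 0) (nilL : lsa_nilpotent L).
Hypotheses (dimL : @has_sdim K L setT k l) (dimL2 : has_sdim (derived L) r s).

(** If L = L² then all terms of the lower central series equal L. *)
Lemma derived_proper m : (r + s = m.+1)%N -> ~ setT `<=` derived L.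
Proof.
move=> ers DT.
have [e [_ _ ie]] := graded_has_dim
  (ideal_graded (derived_ideal L)) (ideal_subspace (derived_ideal L)) dimL2.
have [n Ln] := nilL.
have lcsT i : setT `<=` lcs L i.
  elim: i => // i IHi; apply: subset_trans DT _; apply: br_set_mono => //; exact: IHi.
have e0 i : e i = 0 by have := lcsT n (e i) Logic.I; rewrite Ln.
have i0 : 'I_(r + s) by rewrite ers; exact: ord0.
have := ie (fun=> 1) _ i0; rewrite big1 => [/(_ erefl)/eqP|i _]; last by rewrite e0 scaler0.
by rewrite oner_eq0.
Qed.

(** As dim L² = 1, the last nonzero term of the lower central series is <[a, b]>,
    which is therefore central. *)
Lemma heis_of_pair a b : (r + s = 1)%N -> homog L false a -> homog L false b ->
  a ∙ b != 0 ->
  (forall c d, homogeneous c -> homogeneous d ->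
    a ∙ c = 0 -> b ∙ c = 0 -> a ∙ d = 0 -> b ∙ d = 0 -> c ∙ d = 0) ->
  lsa_iso L (lsa_dsum (lsa_heis K) (lsa_abelian K (k - 3) l)).
Proof.
move=> ers ha hb z0 perp.
have := graded_has_dim (ideal_graded (derived_ideal L)) (ideal_subspace (derived_ideal L)) dimL2.
rewrite ers => -[e [_ se _]].
have line x : derived L x -> exists c, x = c *: e ord0.
  by move=> /se[c]; rewrite big_ord1 => /subr0_eq ->; exists (c ord0).
have [c ec] := line _ (derived_br a b).
have c0 : c != 0 by apply: contra_neq z0 => c0; rewrite ec c0 scale0r.
have dz x : derived L x -> exists c, x = c *: (a ∙ b).
  by move=> /line[c' ->]; exists (c' / c); rewrite ec scalerA mulfVK.
have [s' [_ Ds ns s'0]] : exists s', [/\ homogeneous s', derived L s', ~ [set 0] s'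
    & forall y, [set 0] (s' ∙ y)].
  apply: exists_central_modulo; first exact: ideal0.
    by case: nilL => n Ln; exists n; rewrite Ln.
  by move=> /(_ _ (derived_br a b))/eqP; rewrite (negPf z0).
apply: (heis_structure char2 dimL ha hb z0) => // [x y|y]; first by apply: dz; apply: derived_br.
have [c' es] := dz _ Ds.
have c'0 : c' != 0 by apply: contra_notN ns => /eqP c'0; rewrite es c'0 scale0r.
have /= := s'0 y; rewrite es brZl => /eqP.
by rewrite scaler_eq0 (negPf c'0) => /eqP.
Qed.

End Equality.

(** This makes the truncated difference k - 3 in the model a true one. *)
Lemma iso_dim_ge3 (K : fieldType) (L : lieSuperalgebra K) k l a b :
  @has_sdim K L setT k l -> lsa_iso L (lsa_dsum (lsa_heis K) (lsa_abelian K a b)) -> (3 <= k)%N.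
Proof.
set M := lsa_dsum _ _; move=> [dim0 _] [f [hf [g fg gf]]].
pose v (i : 'I_3) := g ((delta_mx 0 i : 'rV[K]_3), 0).
rewrite -[3%N]card_ord; apply: (indepm_le_quot_dim (f := v) _ _ _ dim0).
- exact: subspace_zero.
- move=> i; split=> //.
  have h : homog M false ((delta_mx 0 i : 'rV[K]_3), 0).
    by split=> //; apply: subspace0; apply: lsa_homog_subspace.
  have [x hx fx] := homog_lift hf (fun y => ex_intro _ (g y) (gf y)) h.
  by rewrite /v -fx fg.
- move=> c /= e i.
  have /(congr1 f) := e; rewrite (lin_sum (hom_lin hf)) (lin0 (hom_lin hf)).
  rewrite (eq_bigr (fun i => c i *: (((delta_mx 0 i : 'rV[K]_3), 0) : M))).
    move=> e0; pose co (x : M) : K^o := heis_coord i x.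
    have coord_lin : forall c x y, co (c *: x + y) = c *: co x + co y.
      exact: heis_coord_lin.
    have := congr1 co e0; rewrite (lin_sum coord_lin) (lin0 coord_lin).
    rewrite (bigD1 i) //= (linZ coord_lin) big1 => [|j ne_ji].
      by rewrite addr0 /co /heis_coord /= mxE !eqxx => /eqP; rewrite mulf_eq0 oner_eq0 orbF => /eqP.
    by rewrite (linZ coord_lin) /co /heis_coord /= mxE eq_sym (negPf ne_ji) scaler0.
  by move=> j _; rewrite (linZ (hom_lin hf)) /v gf.
Qed.

Theorem theorem5p17 (K : closedFieldType) (hchar : (2%:R : K) != 0)
    (L : lieSuperalgebra K) (k l r s : nat)
    (hnil : lsa_nilpotent L)
    (hdim : @has_sdim K L setT k l)
    (hdim2 : has_sdim (derived L) r s)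
    (hrs : (1 <= r + s)%N)
    (P : free_presentation L) :
  exists d : nat,
    [/\ mult2_dim P d,
        (d%:R : rat) <=
          1 / 3%:R * (k%:R + l%:R - r%:R - s%:R) *
            ((k%:R + l%:R + 2%:R * r%:R + 2%:R * s%:R - 2%:R) *
               (k%:R + l%:R - r%:R - s%:R - 1) +
             3%:R * (r%:R + s%:R - 1)) + 3%:R,
        (d%:R : rat) <=
          1 / 3%:R * (k%:R + l%:R) * (k%:R + l%:R - 1) *
            (k%:R + l%:R - 2%:R) + 3%:R
      & (d%:R : rat) =
          1 / 3%:R * (k%:R + l%:R) * (k%:R + l%:R - 1) *
            (k%:R + l%:R - 2%:R) + 3%:R <->
        lsa_iso L (lsa_dsum (lsa_heis K) (lsa_abelian K (k - 3) l))].
Proof.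
have [m em] : exists m, (r + s = m.+1)%N by exists (r + s).-1; rewrite prednK.
have hf := fp_projP P; have f_surj := fp_surj P.
set f := fp_proj P in hf f_surj.
have [t [v [hv sv et iD [DD RD DR DRdim]]]] := presentation_data hdim hdim2 hf f_surj.
have iR := hker_ideal hf; have nilR := hker_nil hnil hf.
rewrite (cubic_bound_eq et em) (refined_bound_eq et em).
rewrite em in DRdim.
have sQ := double_br_subspace (hker f).
have [T [e [He cardT]]] := mult2_upper hchar iD DD hv sv iR RD DR nilR DRdim.
have [d le_dT Hd] := quot_dim_spanm sQ He.
have le_d : (d <= #|{: hall t}| + m * t ^ 2 + 3)%N by rewrite -cardT.
have le_d' : (d <= #|{: hall (t + m)}| + 3)%N.
  by have := refined_le_cubic t m; lia.
exists d; split; [exact: Hd | by rewrite ler_nat | by rewrite ler_nat |].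
rewrite (rwP eqP) eqr_nat -(rwP eqP); split=> [ed|isoL].
  have t_gt0 : (0 < t)%N.
    rewrite lt0n; apply/negP => /eqP t0; case: (derived_proper hnil hdim2 em) => y _.
    have [x <-] := f_surj y; have [c] := sv x Logic.I.
    rewrite big1 ?subr0 // => i _; by have := ltn_ord i; rewrite {2}t0.
  have m0 : m = 0%N.
    apply/eqP; rewrite -leqn0 leqNgt; apply/negP => m_gt0.
    by have := refined_lt_cubic t_gt0 m_gt0; lia.
  rewrite m0 in em DRdim; rewrite m0 addn0 in ed.
  case: (lcs2_line_bound hchar iD DD hv sv iR RD DR nilR DRdim) => [[e2 He2]|].
    have : (d <= #|{: hall t + 'I_2}|)%N.
      by apply: (quot_dim_le_spanm sQ Hd); apply: subset_trans He2; apply: subIsetr.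
    by rewrite card_sum card_ord ed leq_add2l.
  move=> [[a [b [ha hb nRab perp]]] _].
  apply: (heis_of_pair (a := f a) (b := f b) hchar hnil hdim hdim2 em).
  - exact: (hom_homog hf).
  - exact: (hom_homog hf).
  - by apply/eqP => e0; apply: nRab; rewrite /hker /= (hom_br hf).
  - move=> c' d' [i hc] [j hd].
    have [c hc' <-] := homog_lift hf f_surj hc; have [u hu' <-] := homog_lift hf f_surj hd.
    rewrite -!(hom_br hf); apply: perp; by [exists i | exists j].
(* The lower bound attached to k + l - 1 = t + m generators already equals the
   second upper bound, whatever m is. *)
have k3 := iso_dim_ge3 hdim isoL.
have [phi [hphi [phi' phiK phi'K]]] := isoL.
have hpf : lsa_hom (fun x => phi (f x)).
  split=> [c x y|i x hx|x y].
  - by rewrite (hom_lin hf) (hom_lin hphi).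
  - exact/(hom_homog hphi)/(hom_homog hf).
  - by rewrite (hom_br hf) (hom_br hphi).
have kerE : hker (fun x => phi (f x)) = hker f.
  apply/seteqP; split=> x; rewrite /hker /= => e0; last by rewrite e0 (lin0 (hom_lin hphi)).
  by apply: (can_inj phiK); rewrite e0 (lin0 (hom_lin hphi)).
have hpf_surj y : exists x, phi (f x) = y.
  by have [x fx] := f_surj (phi' y); exists x; rewrite fx phi'K.
have lower := mult2_lower hchar hpf hpf_surj (fp_freeP P) (d := d).
rewrite kerE in lower; have {}lower := lower Hd.
have et' : (t + m = 2 + (k - 3 + l))%N by lia.
by apply/eqP; rewrite eqn_leq le_d' et' lower.
Qed.
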